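(* Let $m\ge2$ be an integer, and let $f(x_1)$, $g(x_2)$, $h(x_3)$ be smooth functions on open intervals with $f'(x_1)g'(x_2)h'(x_3)\neq0$ and $f''(x_1)g''(x_2)h''(x_3)\ne0$ everywhere. Let $M$ be the (nonempty) separable surface in $(\mathbb{R}^3,\|\cdot\|_{2m})$ given by $f(x_1)+g(x_2)+h(x_3)=0$, and suppose that $M$ is minimal. Put $u=f(x_1)$, $v=g(x_2)$, $w=h(x_3)$ and define functions $X,Y,Z$ of $u,v,w$ respectively by $$X(u)=(f'(x_1))^{\frac{2m}{2m-1}},\quad Y(v)=(g'(x_2))^{\frac{2m}{2m-1}},\quad Z(w)=(h'(x_3))^{\frac{2m}{2m-1}}.$$ Then, on the ranges of values of $u,v,w$ attained at points of $M$, there is a constant $a$ with $$\frac{X'''}{X'}=\frac{Y'''}{Y'}=\frac{Z'''}{Z'}=a,$$ and the following holds for some real constants $p_i,q_i,r_i$, $1\le i\le3$. (i) If $a>0$, $a=b^2$ with $b>0$, then $$X(u)=p_1+q_1e^{bu}+r_1e^{-bu},\quad Y(v)=p_2+q_2e^{bv}+r_2e^{-bv},\quad Z(w)=p_3+q_3e^{bw}+r_3e^{-bw},$$ where $$\begin{aligned} &(p_2+p_3)r_1-2q_2q_3=0, && (p_1+p_3)r_2-2q_1q_3=0,\\ &(p_2+p_3)q_1-2r_2r_3=0, && (p_1+p_3)q_2-2r_1r_3=0,\\ &(p_1+p_2)q_3-2r_1r_2=0, && (p_1+p_2)r_3-2q_1q_2=0. \end{aligned}$$ (ii) If $a<0$,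 $a=-b^2$ with $b>0$, then $$X(u)=p_1+q_1\cos(bu)+r_1\sin(bu),\quad Y(v)=p_2+q_2\cos(bv)+r_2\sin(bv),\quad Z(w)=p_3+q_3\cos(bw)+r_3\sin(bw),$$ where $$\begin{aligned} &(p_2+p_3)q_1-q_2q_3+r_2r_3=0, && (p_2+p_3)r_1+q_2r_3+q_3r_2=0,\\ &(p_1+p_3)q_2-q_1q_3+r_1r_3=0, && (p_1+p_3)r_2+q_1r_3+q_3r_1=0,\\ &(p_1+p_2)q_3-q_1q_2+r_1r_2=0, && (p_1+p_2)r_3+q_1r_2+q_2r_1=0. \end{aligned}$$ (iii) If $a=0$, then $$X(u)=p_1+q_1u+r_1u^2,\quad Y(v)=p_2+q_2v+r_2v^2,\quad Z(w)=p_3+q_3w+r_3w^2,$$ where $$\begin{aligned} &(p_2+p_3)q_1+(p_1+p_3)q_2+(p_1+p_2)q_3=0,\\ &2(p_2+p_3)r_1-2(p_1+p_2)r_3+q_2(q_1-q_3)=0,\\ &2(p_1+p_3)r_2-2(p_1+p_2)r_3+q_1(q_2-q_3)=0,\\ &(q_2-q_3)r_1-(q_1-q_2)r_3=0,\\ &(q_1-q_3)r_2+(q_1-q_2)r_3=0,\\ &r_1r_2+r_1r_3+r_2r_3=0. \end{aligned}$$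
   Context: $\|x\|_{2m}=(x_1^{2m}+x_2^{2m}+x_3^{2m})^{1/(2m)}$ on $\mathbb{R}^3$, $\Phi(x)=x_1^{2m}+x_2^{2m}+x_3^{2m}$, and $S=\{x\in\mathbb{R}^3:\Phi(x)=1\}$ is the unit sphere. A nonzero vector $v$ is Birkhoff orthogonal to a plane $\Pi$ if the tangent plane of $S$ at $v/\|v\|_{2m}$ is parallel to $\Pi$. For an immersed surface $M$, the (local) Birkhoff-Gauss map $\eta:M\to S$ is a smooth choice of $\eta(p)\in S$ Birkhoff orthogonal to $T_pM$; for the surface $f(x_1)+g(x_2)+h(x_3)=0$ it is characterized by $(\operatorname{grad}\Phi)_{\eta}=\varphi\,(f',g',h')$ for a positive function $\varphi$. Since the tangent plane of $S$ at $\eta(p)$ is parallel to $T_pM$, $d\eta_p$ is regarded as an endomorphism of $T_pM$. The mean curvature is $H=\frac12\operatorname{trace}(d\eta_p)$, and $M$ is called minimal if $H=0$ identically. For real $x$, $x^{\frac{2m}{2m-1}}$ means $(x^{\frac1{2m-1}})^{2m}$ with the real $(2m-1)$-th root. Since $f',g',h'$ do not vanish, $f,g,h$ are injective, so $X,Y,Z$ are well-defined smooth positive functions of $u,v,w$; primes on $X,Y,Z$ denote derivatives in $u,v,w$ respectively. *)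

(* Defs.v *)
From HB Require Import structures.
From mathcomp Require Import all_boot all_order all_algebra.
From mathcomp Require Import all_classical all_reals all_analysis.

Set Implicit Arguments.
Unset Strict Implicit.
Unset Printing Implicit Defensive.

Import Order.TTheory GRing.Theory Num.Theory.
Import numFieldNormedType.Exports.

Local Open Scope ring_scope.
Local Open Scope classical_set_scope.

Definition smooth_at {R : realType} {V : normedModType R} (f : R -> V) (t : R) :
    Prop :=
  forall n : nat, derivable f^`(n) t 1.

Definition smooth_on {R : realType} {V : normedModType R} (I : set R)
    (f : R -> V) : Prop :=
  forall t, I t -> smooth_at f t.

Definition iter_partial {R : realType} (s : seq 'I_3) (F : 'rV[R]_3 -> 'rV[R]_3) :
    'rV[R]_3 -> 'rV[R]_3 :=
  foldr (fun i G => fun x => 'D_(delta_mx 0 i) G x) F s.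

(* When this holds at every point of a neighborhood of x, F is C^infinity
   there. *)
Definition smooth3_at {R : realType} (F : 'rV[R]_3 -> 'rV[R]_3) (x : 'rV[R]_3) :
    Prop :=
  forall s : seq 'I_3, differentiable (iter_partial s F) x.

(* Real n-th root for odd n. Since powR is not a root on negative numbers, the
   sign is factored out. *)
Definition odd_root {R : realType} (n : nat) (x : R) : R :=
  Num.sg x * (`|x| `^ (n%:R^-1)).

Definition Phi {R : realType} (m : nat) (x : 'rV[R]_3) : R :=
  \sum_(i < 3) x 0 i ^+ (2 * m).

Definition norm2m {R : realType} (m : nat) (x : 'rV[R]_3) : R :=
  Phi m x `^ ((2 * m)%:R^-1).

Definition unit_sphere {R : realType} (m : nat) : set 'rV[R]_3 :=
  [set x | Phi m x = 1].

(* Velocities at p of smooth curves lying in A: the direction plane of the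
   tangent plane when A is a surface. Planes are represented by their
   directions, so that parallel planes are equal. *)
Definition tangent_plane {R : realType} (A : set 'rV[R]_3) (p : 'rV[R]_3) :
    set 'rV[R]_3 :=
  [set v | exists c : R -> 'rV[R]_3,
     [/\ \forall t \near (0 : R), A (c t) /\ smooth_at c t,
         c 0 = p & c^`() 0 = v]].

Definition birkhoff_orthogonal {R : realType} (m : nat) (v : 'rV[R]_3)
    (P : set 'rV[R]_3) : Prop :=
  v != 0 /\ tangent_plane (unit_sphere m) ((norm2m m v)^-1 *: v) = P.

(* eta is a Birkhoff-Gauss map of M on a neighborhood of p. Only the values of
   eta on M matter; off M, eta is an arbitrary smooth extension. *)
Definition birkhoff_gauss_near {R : realType} (m : nat) (M : set 'rV[R]_3)
    (eta : 'rV[R]_3 -> 'rV[R]_3) (p : 'rV[R]_3) : Prop :=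
  \forall q \near p, smooth3_at eta q /\
    (M q -> unit_sphere m (eta q) /\
            birkhoff_orthogonal m (eta q) (tangent_plane M q)).

(* P is a plane with basis the rows of B, L restricts to an endomorphism of P
   whose matrix in this basis is A, and t is its trace. *)
Definition trace_on_plane {R : realType} (P : set 'rV[R]_3)
    (L : 'rV[R]_3 -> 'rV[R]_3) (t : R) : Prop :=
  exists (B : 'M[R]_(2, 3)) (A : 'M[R]_2),
    [/\ row_free B, P = [set v | (v <= B)%MS],
        (forall i, L (row i B) = row i (A *m B)) & t = \tr A].

Definition mean_curvature {R : realType} (M : set 'rV[R]_3)
    (eta : 'rV[R]_3 -> 'rV[R]_3) (p : 'rV[R]_3) (H : R) : Prop :=
  exists t : R,
    trace_on_plane (tangent_plane M p) ('d eta p) t /\ H = 2^-1 * t.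

(* Local Birkhoff-Gauss maps at p agree near p up to sign, and replacing eta by
   - eta replaces H by - H, so the choice of eta is immaterial. *)
Definition minimal_surface {R : realType} (m : nat) (M : set 'rV[R]_3) : Prop :=
  forall p, M p -> exists eta : 'rV[R]_3 -> 'rV[R]_3,
    birkhoff_gauss_near m M eta p /\ mean_curvature M eta p 0.

Definition separable_surface {R : realType} (I1 I2 I3 : set R) (f g h : R -> R) :
    set 'rV[R]_3 :=
  [set x | [/\ I1 (x 0 0), I2 (x 0 1), I3 (x 0 2) &
               f (x 0 0) + g (x 0 1) + h (x 0 2) = 0]].

(* Main.v *)
(* With [nu_i = (f_i')^(1/(2m-1))], a Birkhoff-Gauss map is [eta = k nu] for a
   scalar function [k], and the tangent plane is the kernel of
   [n = (f', g', h')]. Modulo [nu], [d eta] is [k diag(nu_i')], so its trace on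
   [ker n] is that of [k diag(nu_i')] followed by the projection onto [ker n]
   along [nu]. As [n_i nu_i] is [X], [Y], [Z] and [nu_i'] is [X'], [Y'], [Z'] up
   to the factor [2m], minimality becomes
     X'(Y + Z) + Y'(X + Z) + Z'(X + Y) = 0   on   u + v + w = 0.
   Differentiating in [u] and then in [v], and eliminating, expresses
   [X'''/X'], [Y'''/Y'] and [Z'''/Z'] by one symmetric formula; each depends on
   one variable only, hence they are one constant [a]. Solving [X''' = a X'] and
   substituting back into
     X'''(Y + Z) + Y''(Z' - X') + Z''(Y' - X') = 0
   leaves a combination of [exp(bu)] and [exp(-bu)] (resp. of [sin(bu)] and
   [cos(bu)], of [1] and [u]), whose coefficients therefore vanish. *)
Require Import Defs.
From HB Require Import structures.
From mathcomp Require Import all_boot all_order all_algebra.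
From mathcomp Require Import all_classical all_reals all_analysis.
From mathcomp Require Import ring lra.
Set Implicit Arguments.
Unset Strict Implicit.
Unset Printing Implicit Defensive.

Import Order.TTheory GRing.Theory Num.Theory.
Import numFieldNormedType.Exports.
Local Open Scope ring_scope.
Local Open Scope classical_set_scope.

(** * Smooth functions of one variable *)

(** A Birkhoff-Gauss map is given only through an equality of tangent planes, with an unknown scalar
    [k] in [eta = k nu]. It is used in the cross form [eta_i nu_j = eta_j nu_i], which can be
    differentiated along curves of M without any knowledge of how [k] varies, and whose derivative
    determines [d eta] modulo [nu]. [X], [Y], [Z] are even powers of nonzero numbers, hence
    positive: this keeps [n nu = X + Y + Z] and the sums [Y + Z], [X + Z], [X + Y], by which the
    elimination divides, away from zero. The values of u met on M may fill only part of the range of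
    [f]. They are still the projection of a convex set, hence an interval, and they form an open
    set: the first fact turns local constancy of [X'''/X'] into constancy and lets the ODE be
    integrated, the second lets coefficients be compared by differentiation. For [a = 0] the
    substituted relation yields only two of the six conditions. Exchanging X and Y yields a third;
    the other three come from the undifferentiated equation and its first derivatives. *)

Lemma is_derive_add (R : realType) (f g : R -> R) (x a b : R) :
  is_derive x 1 f a -> is_derive x 1 g b ->
  is_derive x 1 (fun y => f y + g y) (a + b).
Proof. by move=> ? ?; apply: is_deriveD. Qed.

Lemma is_derive_opp (R : realType) (f : R -> R) (x a : R) :
  is_derive x 1 f a -> is_derive x 1 (fun y => - f y) (- a).
Proof. by move=> ?; apply: is_deriveN. Qed.

Lemma is_derive_mul (R : realType) (f g : R -> R) (x a b : R) :
  is_derive x 1 f a -> is_derive x 1 g b ->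
  is_derive x 1 (fun y => f y * g y) (a * g x + f x * b).
Proof.
move=> fa gb; have := is_deriveM fa gb.
by move=> /is_derive_eq; apply; rewrite addrC [a * _]mulrC.
Qed.

Lemma is_derive_exp (R : realType) (f : R -> R) (n : nat) (x a : R) :
  is_derive x 1 f a ->
  is_derive x 1 (fun y => f y ^+ n) (n%:R * f x ^+ n.-1 * a).
Proof.
by move=> fa; rewrite -(exprfctE f); exact: is_deriveX.
Qed.

Lemma is_derive_comp (R : realType) (f g : R -> R) (x a b : R) :
  is_derive (g x) 1 f a -> is_derive x 1 g b ->
  is_derive x 1 (fun y => f (g y)) (a * b).
Proof. by move=> ? ?; apply: is_derive1_comp. Qed.

Lemma is_derive_affine (R : realType) (c s x : R) :
  is_derive x 1 (fun y => c + s * y) s.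
Proof.
have D := is_derive_add (is_derive_cst c x (1 : R))
  (is_derive_mul (is_derive_cst s x (1 : R)) (is_derive_id x (1 : R))).
by apply: is_derive_eq D _; rewrite add0r mul0r add0r mulr1.
Qed.

Lemma is_derive_linear (R : realType) (s x : R) :
  is_derive x 1 (fun y => s * y) s.
Proof. by have := is_derive_affine 0 s x; under eq_fun do rewrite add0r. Qed.

Lemma is_derive_derive1 (R : realType) (V : normedModType R) (f : R -> V)
    (x : R) (a : V) :
  is_derive x 1 f a -> f^`() x = a.
Proof. by move=> ?; rewrite derive1E derive_val. Qed.

Lemma derivable_is_derive (R : realType) (V : normedModType R) (f : R -> V)
    (x : R) :
  derivable f x 1 -> is_derive x 1 f (f^`() x).
Proof. by move=> ?; rewrite derive1E; apply: derivableP. Qed.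

Lemma near_eq_is_derive1 (R : realType) (V : normedModType R) (f g : R -> V)
    (x : R) (a : V) :
  {near x, f =1 g} -> is_derive x 1 f a -> is_derive x 1 g a.
Proof.
by move=> fg fa; apply: near_eq_is_derive fa; rewrite ?oner_eq0.
Qed.

Lemma is_derive_row (R : realType) (f : 'I_3 -> R -> R) (a : 'I_3 -> R)
    (t : R) :
  (forall i, is_derive t 1 (f i) (a i)) ->
  is_derive t 1 (fun s => \row_i f i s : 'rV[R]_3) (\row_i a i).
Proof.
move=> fa.
have D : derivable (fun s => \row_i f i s : 'rV[R]_3) t 1.
  apply/derivable_mxP => i j; have [+ _] := fa j.
  by under [in X in _ -> X]eq_fun do rewrite mxE.
apply: DeriveDef => //; rewrite derive_mx//; apply/rowP => j; rewrite !mxE.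
by under eq_fun do rewrite mxE; have [_ ->] := fa j.
Qed.

(** Smoothness of finite order, by recursion on the derivative: closure under products and inverses
    becomes an induction on [n] in which the factors are needed only to lower order. *)
Fixpoint derivable_upto (R : realType) (V : normedModType R) (n : nat)
    (I : set R) (f : R -> V) : Prop :=
  if n is n'.+1 then
    (forall t, I t -> derivable f t 1) /\ derivable_upto n' I f^`()
  else True.

Lemma smooth_onE (R : realType) (V : normedModType R) (I : set R)
    (f : R -> V) :
  smooth_on I f <-> forall n, derivable_upto n I f.
Proof.
split.
  move=> sf n; elim: n f sf => [//|n IH] f sf /=; split.
    by move=> t It; exact: (sf t It 0).
  by apply: IH => t It k; rewrite -derive1Sn; exact: sf.
move=> sf t It n; elim: n f sf => [|n IH] f sf.
  by have [/(_ t It)] := sf 1.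
by rewrite derive1Sn; apply: IH => k; have [] := sf k.+1.
Qed.

Section SmoothCalculus.
Context {R : realType} {I : set R}.
Hypothesis oI : open I.

Lemma eqI_is_derive (V : normedModType R) (f g : R -> V) (x : R) (a : V) :
  (forall t, I t -> f t = g t) -> I x -> is_derive x 1 f a ->
  is_derive x 1 g a.
Proof.
move=> fg Ix; apply: near_eq_is_derive1.
by apply: filterS (open_nbhs_nbhs (conj oI Ix)).
Qed.

Lemma eqI_derivable_upto (V : normedModType R) n (f g : R -> V) :
  (forall t, I t -> f t = g t) -> derivable_upto n I f -> derivable_upto n I g.
Proof.
elim: n f g => [//|n IH] f g fg [df sf]; split.
  move=> t It; have /derivable_is_derive := df t It.
  by move=> /(eqI_is_derive fg It) [].
apply: IH sf => t It; apply/esym/is_derive_derive1.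
exact: (eqI_is_derive fg It (derivable_is_derive (df t It))).
Qed.

(** Introduction rule: since [I] is open, the derivative may be replaced by any formula [g] valid on
    [I] only. *)
Lemma derivable_uptoS (V : normedModType R) n (f g : R -> V) :
  (forall t, I t -> is_derive t 1 f (g t)) -> derivable_upto n I g ->
  derivable_upto n.+1 I f.
Proof.
move=> fg sg; split; first by move=> t /fg [].
by apply: eqI_derivable_upto sg => t /fg /is_derive_derive1.
Qed.

Lemma derivable_uptoW (V : normedModType R) n (f : R -> V) :
  derivable_upto n.+1 I f -> derivable_upto n I f.
Proof.
elim: n f => [//|n IH] f [df sf]; split => //.
by apply: IH.
Qed.

Lemma derivable_upto_cst n (c : R) : derivable_upto n I (fun=> c).
Proof.
elim: n c => [//|n IH] c; apply: derivable_uptoS (IH 0) => t _.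
Qed.

Lemma derivable_upto_id n : derivable_upto n I (fun x : R => x).
Proof.
case: n => [//|n]; apply: derivable_uptoS (derivable_upto_cst n 1) => t _.
Qed.

Lemma derivable_uptoD n (f g : R -> R) :
  derivable_upto n I f -> derivable_upto n I g ->
  derivable_upto n I (fun x => f x + g x).
Proof.
elim: n f g => [//|n IH] f g [df sf] [dg sg].
apply: derivable_uptoS (IH _ _ sf sg) => t It.
by apply: is_derive_add; apply: derivable_is_derive; [exact: df|exact: dg].
Qed.

Lemma derivable_uptoM n (f g : R -> R) :
  derivable_upto n I f -> derivable_upto n I g ->
  derivable_upto n I (fun x => f x * g x).
Proof.
elim: n f g => [//|n IH] f g fn gn.
have [[df sf] [dg sg]] := (fn, gn).
have D t : I t ->
    is_derive t 1 (fun x => f x * g x) (derive1 f t * g t + f t * derive1 g t).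
  by move=> It; apply: is_derive_mul; apply: derivable_is_derive;
    [exact: df | exact: dg].
apply: derivable_uptoS D _.
by apply: derivable_uptoD; apply: IH => //; exact: derivable_uptoW.
Qed.

Lemma derivable_uptoX n k (f : R -> R) :
  derivable_upto n I f -> derivable_upto n I (fun x => f x ^+ k).
Proof.
move=> fn; elim: k => [|k IH]; first exact: derivable_upto_cst.
by under eq_fun do rewrite exprS; exact: derivable_uptoM.
Qed.

Lemma derivable_uptoV n (f : R -> R) : (forall t, I t -> f t != 0) ->
  derivable_upto n I f -> derivable_upto n I (fun x => (f x)^-1).
Proof.
move=> f0; elim: n => [//|n IH] fn; have [df sf] := fn.
have D t : I t -> is_derive t 1 (fun x => (f x)^-1)
    (-1 * ((f t)^-1 * (f t)^-1 * derive1 f t)).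
  move=> It.
  apply: is_derive_eq (is_deriveV (f0 _ It) (derivable_is_derive (df t It))) _.
  by rewrite /GRing.scale/= expr2 invfM mulN1r mulNr.
apply: derivable_uptoS D _.
apply: derivable_uptoM; first exact: derivable_upto_cst.
have fVn := IH (derivable_uptoW fn).
by apply: derivable_uptoM => //; apply: derivable_uptoM.
Qed.

Lemma derivable_upto_row n (f : 'I_3 -> R -> R) :
  (forall i, derivable_upto n I (f i)) ->
  derivable_upto n I (fun t => \row_i f i t : 'rV[R]_3).
Proof.
elim: n f => [//|n IH] f fn.
have D t : I t -> is_derive t 1 (fun t => \row_i f i t : 'rV[R]_3)
    (\row_i derive1 (f i) t).
  move=> It; apply: is_derive_row => i; apply: derivable_is_derive.
  by have [/(_ t It)] := fn i.
by apply: derivable_uptoS D _; apply: IH => i; have [] := fn i.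
Qed.

End SmoothCalculus.

(** * Inverse functions and odd roots *)

(* An arbitrary value when [y] is not in [f @` I]. *)
Definition local_inverse {R : realType} (I : set R) (f : R -> R) (y : R) : R :=
  get [set x | I x /\ f x = y].

Section LocalInverse.
Context {R : realType} {I : set R} {f : R -> R}.
Hypotheses (oI : open I) (iI : is_interval I).
Hypothesis df : forall t, I t -> derivable f t 1.
Hypothesis f'_neq0 : forall t, I t -> derive1 f t != 0.

Let cf t : I t -> {for t, continuous f}.
Proof. by move=> /df/derivable1_diffP/differentiable_continuous. Qed.

Lemma derivable_interval_inj x y : I x -> I y -> f x = f y -> x = y.
Proof.
wlog xy : x y / x < y => [H Ix Iy fxy|Ix Iy fxy].
  case: (ltgtP x y) => // h; first exact: H.
  by apply/esym; apply: H.
have Ixy z : x <= z <= y -> I z by move=> ?; apply: (iI Ix Iy).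
have [z||z + E] := @MVT R f (derive1 f) x y xy.
- rewrite in_itv/= => /andP[/ltW ? /ltW ?].
  by apply/derivable_is_derive/df/Ixy/andP.
- apply: continuous_in_subspaceT => z; rewrite inE/= in_itv/= => zxy.
  exact/cf/Ixy.
- rewrite in_itv/= => /andP[/ltW xz /ltW zy].
  move: E; rewrite fxy subrr => /esym/eqP; rewrite mulf_eq0 subr_eq0.
  have /f'_neq0/negbTE -> : I z by apply: Ixy; rewrite xz.
  by rewrite gt_eqF.
Qed.

Lemma local_inverseK x : I x -> local_inverse I f (f x) = x.
Proof.
move=> Ix; have [] : [set z | I z /\ f z = f x] (local_inverse I f (f x)).
  by apply: getPex; exists x.
by move=> Iz fzx; exact: derivable_interval_inj.
Qed.

Let near_cancel x : I x -> {near x, cancel f (local_inverse I f)}.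
Proof.
move=> Ix; apply: filterS (open_nbhs_nbhs (conj oI Ix)) => y Iy.
exact: local_inverseK.
Qed.

Let near_continuous x : I x -> {near x, continuous f}.
Proof.
move=> Ix; apply: filterS (open_nbhs_nbhs (conj oI Ix)) => y Iy.
exact: cf.
Qed.

Lemma is_derive_local_inverse x : I x ->
  is_derive (f x) 1 (local_inverse I f) (derive1 f x)^-1.
Proof.
move=> Ix; apply: is_derive_inverse.
- exact: near_cancel.
- exact: near_continuous.
- exact/derivable_is_derive/df.
- exact: f'_neq0.
Qed.

(** The local inverse is continuous at [f x] and sends it into the open set [I], so it sends a whole
    neighborhood of [f x] into [I], where it provides preimages. *)
Lemma open_image_interval : open (f @` I).
Proof.
rewrite openE => _ [x Ix <-].
have fK : \forall y \near f x, f (local_inverse I f y) = y.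
  exact: near_continuous_can_sym (near_continuous Ix) (near_cancel Ix).
have [/derivable1_diffP/differentiable_continuous gc _] :=
  is_derive_local_inverse Ix.
have gI : \forall y \near f x, I (local_inverse I f y).
  by apply: gc; rewrite local_inverseK//; exact: open_nbhs_nbhs.
by apply: filterS2 fK gI => y fgy Igy; exists (local_inverse I f y).
Qed.

Lemma is_interval_image : is_interval (f @` I).
Proof.
apply/connected_intervalP/connected_continuous_connected.
  exact/connected_intervalP.
by apply: continuous_in_subspaceT => x; rewrite inE; exact: cf.
Qed.

(** [X] is known only through the values [X (f t)], so its derivative in u is the derivative in t
    divided by [f']. *)
Lemma is_derive_pushforward (F phi : R -> R) x a :
  (forall t, I t -> F (f t) = phi t) -> I x -> is_derive x 1 phi a ->
  is_derive (f x) 1 F (a * (derive1 f x)^-1).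
Proof.
move=> Fphi Ix phia.
have D : is_derive (f x) 1 (fun y => phi (local_inverse I f y))
    (a * (derive1 f x)^-1).
  apply: is_derive_comp; first by rewrite local_inverseK.
  exact: is_derive_local_inverse.
apply: (eqI_is_derive open_image_interval) D; last by exists x.
by move=> _ [t It <-]; rewrite local_inverseK// Fphi.
Qed.

(** The derivative of a pushforward is again one, that of [phi' / f'], which makes the induction go
    through. *)
Lemma derivable_upto_pushforward n (F phi : R -> R) :
  (forall k, derivable_upto k I f) ->
  (forall t, I t -> F (f t) = phi t) -> derivable_upto n I phi ->
  derivable_upto n (f @` I) F.
Proof.
move=> sf; elim: n F phi => [//|n IH] F phi Fphi [dphi sphi].
have D t : I t -> is_derive (f t) 1 F (derive1 phi t * (derive1 f t)^-1).
  move=> It.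
  exact: is_derive_pushforward Fphi It (derivable_is_derive (dphi t It)).
split; first by move=> _ [t It <-]; have [] := D t It.
apply: (IH _ (fun t => derive1 phi t * (derive1 f t)^-1)).
  by move=> t It; exact/is_derive_derive1/D.
apply: derivable_uptoM => //; apply: derivable_uptoV => //.
by have [] := sf n.+1.
Qed.

End LocalInverse.

Lemma odd_2nB1 (m : nat) : (0 < m)%N -> odd (2 * m - 1).
Proof. by move=> m0; rewrite mul2n oddB ?odd_double// double_gt0. Qed.

Lemma sgr_exp_odd (R : realType) (n : nat) (x : R) : odd n ->
  Num.sg x ^+ n = Num.sg x.
Proof.
move=> on; rewrite -(odd_double_half n) on -mul2n exprD exprM expr1.
rewrite sqr_sg; case: eqP => [->|_]; first by rewrite sgr0 mul0r.
by rewrite expr1n mulr1.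
Qed.

Lemma odd_root_expK (R : realType) (n : nat) (x : R) : odd n ->
  odd_root n (x ^+ n) = x.
Proof.
move=> on; have n0 : (n%:R : R) != 0 by rewrite pnatr_eq0; case: n on.
rewrite /odd_root normrX -(@powR_mulrn _ `|x|)// -powRrM mulfV// powRr1// sgrX.
by rewrite sgr_exp_odd// -numEsg.
Qed.

Lemma exp_odd_rootK (R : realType) (n : nat) (x : R) : odd n ->
  odd_root n x ^+ n = x.
Proof.
move=> on; have n0 : (n%:R : R) != 0 by rewrite pnatr_eq0; case: n on.
rewrite /odd_root exprMn -(@powR_mulrn _ (`|x| `^ _)) ?powR_ge0//.
rewrite -powRrM mulVf// powRr1//.
by rewrite sgr_exp_odd// -numEsg.
Qed.

Lemma odd_root_neq0 (R : realType) (n : nat) (x : R) : odd n -> x != 0 ->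
  odd_root n x != 0.
Proof.
move=> on; apply: contra_neq => r0.
by rewrite -(exp_odd_rootK x on) r0 expr0n; case: n on {r0}.
Qed.

(** The root is the inverse of the odd power, whose derivative is nonzero away from the origin. *)
Lemma is_derive_odd_root (R : realType) (n : nat) (x : R) : odd n -> x != 0 ->
  is_derive x 1 (odd_root n) (n%:R * odd_root n x ^+ n.-1)^-1.
Proof.
move=> on x0; rewrite -{1}(exp_odd_rootK x on).
apply: (@is_derive_inverse R (fun y => y ^+ n)).
- by apply: filterE => y; exact: odd_root_expK.
- by apply: filterE => y; exact: exprn_continuous.
- by apply: is_derive_eq (is_derive_exp n (is_derive_id _ _)) _; rewrite mulr1.
- rewrite mulf_neq0//; first by rewrite pnatr_eq0; case: n on.
  exact/expf_neq0/odd_root_neq0.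
Qed.

Section SeparableFactor.
Context {R : realType} {m : nat} {I : set R} {f X : R -> R}.
Hypotheses (m2 : (2 <= m)%N) (oI : open I) (iI : is_interval I).
Hypothesis sf : smooth_on I f.
Hypothesis f'_neq0 : forall t, I t -> derive1 f t != 0.
Hypothesis f''_neq0 : forall t, I t -> derive1 (derive1 f) t != 0.
Hypothesis XE : forall t, I t ->
  X (f t) = odd_root (2 * m - 1) (derive1 f t) ^+ (2 * m).

Let nu t := odd_root (2 * m - 1) (derive1 f t).

Let odd_2m1 : odd (2 * m - 1) := odd_2nB1 (ltnW m2).

Let exp_2m : (2 * m = (2 * m - 1).+1)%N.
Proof. by rewrite subn1 prednK// muln_gt0 (ltn_trans _ m2). Qed.

Let df t : I t -> derivable f t 1.
Proof. by move=> /sf /(_ 0%N). Qed.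

Let sfn n : derivable_upto n I f.
Proof. by have /smooth_onE := sf. Qed.

Let nu_neq0 t : I t -> nu t != 0.
Proof. by move=> /f'_neq0; exact: odd_root_neq0. Qed.

Let is_derive_nu0 t : I t ->
  is_derive t 1 nu
    (((2 * m - 1)%:R * nu t ^+ (2 * m - 1).-1)^-1 * derive1 (derive1 f) t).
Proof.
move=> It; apply: is_derive_comp; first exact: is_derive_odd_root (f'_neq0 It).
by have [_ [df' _]] := sfn 2; exact/derivable_is_derive/df'.
Qed.

(** Bootstrapping: [nu'] is a rational expression in [nu] and [f''], so order [n] for [nu] gives
    order [n + 1]. *)
Let snu n : derivable_upto n I nu.
Proof.
elim: n => [//|n IH]; apply: derivable_uptoS is_derive_nu0 _ => //.
apply: derivable_uptoM => //; last by have [_ []] := sfn n.+2.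
apply: derivable_uptoV => //.
  move=> t It; apply: mulf_neq0; last exact/expf_neq0/nu_neq0.
  by rewrite pnatr_eq0; case: (2 * m - 1)%N odd_2m1.
apply: derivable_uptoM => //; first exact: derivable_upto_cst.
exact: derivable_uptoX.
Qed.

Lemma factor_gt0 t : I t -> 0 < X (f t).
Proof.
move=> It; rewrite XE// exprM exprn_gt0// lt_def sqr_ge0 andbT.
exact/expf_neq0/nu_neq0.
Qed.

Lemma factorE t : I t ->
  X (f t) = odd_root (2 * m - 1) (derive1 f t) * derive1 f t.
Proof.
move=> It; rewrite XE//.
by rewrite -[X in _ = _ * X](exp_odd_rootK _ odd_2m1) -exprS -exp_2m.
Qed.

Lemma smooth_factor n : derivable_upto n (f @` I) X.
Proof.
apply: (derivable_upto_pushforward oI iI df f'_neq0 sfn XE).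
exact: derivable_uptoX (snu n).
Qed.

(** Differentiating [nu^(2m)] produces the factor [nu^(2m-1) = f'], which cancels the [1 / f'] of
    the change of variable. What remains is [2m nu']. *)
Let derive1_factor0 t : I t -> derive1 X (f t) =
  (2 * m)%:R * (((2 * m - 1)%:R * nu t ^+ (2 * m - 1).-1)^-1 *
    derive1 (derive1 f) t).
Proof.
move=> It; apply: is_derive_derive1.
have E : nu t ^+ (2 * m).-1 = derive1 f t.
  by rewrite exp_2m; exact: exp_odd_rootK.
apply: is_derive_eq.
  exact: (is_derive_pushforward oI iI df f'_neq0 XE It
    (is_derive_exp (2 * m) (is_derive_nu0 It))).
rewrite E -!mulrA; congr (_ * _).
by rewrite mulrC -!mulrA mulVf ?f'_neq0// mulr1.
Qed.

Lemma is_derive_normal t : I t ->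
  is_derive t 1 (fun s => odd_root (2 * m - 1) (derive1 f s))
    (derive1 X (f t) / (2 * m)%:R).
Proof.
move=> It; apply: is_derive_eq (is_derive_nu0 It) _.
rewrite derive1_factor0// [RHS]mulrC mulKf//.
by rewrite pnatr_eq0 muln_eq0/= -lt0n (ltn_trans _ m2).
Qed.

(** Here the hypothesis on [f''] enters: it makes the quotient [X'''/X'] meaningful. *)
Lemma derive1_factor_neq0 t : I t -> derive1 X (f t) != 0.
Proof.
move=> It; rewrite derive1_factor0// !mulf_neq0 ?f''_neq0//.
  by rewrite pnatr_eq0 muln_eq0/= -lt0n (ltn_trans _ m2).
rewrite invr_eq0 mulf_neq0//; last exact/expf_neq0/nu_neq0.
by rewrite pnatr_eq0; case: (2 * m - 1)%N odd_2m1.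
Qed.

End SeparableFactor.

(** * The functional equation *)

Lemma open_near_affine (R : realType) (J : set R) (u s : R) :
  open J -> J u -> \forall t \near (0 : R), J (u + s * t).
Proof.
move=> oJ Ju; have [/derivable1_diffP/differentiable_continuous c _] :=
  is_derive_affine u s 0.
by apply: c; rewrite mulr0 addr0; exact: open_nbhs_nbhs.
Qed.

(** In the functional equation, derivatives are taken along lines inside the plane [u + v + w = 0],
    where each coordinate has slope 1, 0 or -1. *)
Lemma is_derive_along (R : realType) (F : R -> R) (u s a : R) :
  is_derive u 1 F a -> is_derive (0 : R) 1 (fun t => F (u + s * t)) (a * s).
Proof.
move=> Fa; apply: is_derive_comp; last exact: is_derive_affine.
by rewrite mulr0 addr0.
Qed.

Lemma is_derive_near0 (R : realType) (F : R -> R) (x a : R) :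
  (\forall t \near x, F t = 0) -> is_derive x 1 F a -> a = 0.
Proof.
move=> F0 Fa; rewrite -(is_derive_derive1 Fa); apply: is_derive_derive1.
apply: (near_eq_is_derive1 _ (is_derive_cst (0 : R) x (1 : R))).
by apply: filterS F0 => t ->.
Qed.

Lemma is_derive0_interval_cst (R : realType) (U : set R) (F : R -> R) :
  is_interval U -> (forall u, U u -> is_derive u 1 F 0) ->
  forall x y, U x -> U y -> F x = F y.
Proof.
move=> iU dF x y; wlog xy : x y / x < y => [H Ux Uy|Ux Uy].
  case: (ltgtP x y) => [h|h|->] //; first exact: H.
  by apply/esym; exact: H.
have Uxy z : x <= z <= y -> U z by move=> ?; apply: (iU x y).
have [z||z _] := @MVT R F (fun=> 0) x y xy.
- by rewrite in_itv/= => /andP[/ltW ? /ltW ?]; apply/dF/Uxy/andP.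
- apply: continuous_in_subspaceT => z; rewrite inE/= in_itv/= => /Uxy/dF[+ _].
  by move=> /derivable1_diffP/differentiable_continuous.
- by rewrite mul0r => /eqP; rewrite subr_eq0 => /eqP.
Qed.

Definition profile {R : realType} (J : set R) (X : R -> R) : Prop :=
  [/\ open J, is_interval J, (forall n, derivable_upto n J X),
      (forall u, J u -> 0 < X u) & (forall u, J u -> derive1 X u != 0)].

Lemma profile_is_derive (R : realType) (J : set R) (X : R -> R) (n : nat)
    (u : R) :
  profile J X -> J u -> is_derive u 1 (derive1n n X) (derive1n n.+1 X u).
Proof.
case=> _ _ /smooth_onE sX _ _ /sX /(_ n).
exact: derivable_is_derive.
Qed.

Definition minimal_eq {R : realType} (J1 J2 J3 : set R) (X Y Z : R -> R) :
    Prop :=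
  forall u v w, J1 u -> J2 v -> J3 w -> u + v + w = 0 ->
    derive1 X u * (Y v + Z w) + derive1 Y v * (X u + Z w) +
    derive1 Z w * (X u + Y v) = 0.

(** With [J1], [J2], [J3] the ranges of [f], [g], [h], these are the values of u occurring at points
    of M. *)
Definition attained {R : realType} (J1 J2 J3 : set R) : set R :=
  [set u | J1 u /\ exists v w, [/\ J2 v, J3 w & u + v + w = 0]].

Section MinimalEq.
Context {R : realType}.

Lemma minimal_eq_swap12 (J1 J2 J3 : set R) (X Y Z : R -> R) :
  minimal_eq J1 J2 J3 X Y Z -> minimal_eq J2 J1 J3 Y X Z.
Proof.
move=> E u v w Ju Jv Jw s; have := E v u w Jv Ju Jw.
by rewrite [v + u]addrC => /(_ s) <-; ring.
Qed.

Lemma minimal_eq_swap23 (J1 J2 J3 : set R) (X Y Z : R -> R) :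
  minimal_eq J1 J2 J3 X Y Z -> minimal_eq J1 J3 J2 X Z Y.
Proof.
move=> E u v w Ju Jv Jw s; have := E u w v Ju Jw Jv.
by rewrite addrAC => /(_ s) <-; ring.
Qed.

(** The equation is differentiated along [(u + t, v, w - t)]; the two [X' Z'] terms cancel. *)
Lemma minimal_eq_d1 (J1 J2 J3 : set R) (X Y Z : R -> R) u v w :
  profile J1 X -> profile J2 Y -> profile J3 Z -> minimal_eq J1 J2 J3 X Y Z ->
  J1 u -> J2 v -> J3 w -> u + v + w = 0 ->
  derive1n 2 X u * (Y v + Z w) + derive1 X u * derive1 Y v =
  derive1n 2 Z w * (X u + Y v) + derive1 Y v * derive1 Z w.
Proof.
move=> pX pY pZ E Ju Jv Jw s.
have [[oJ1 _ _ _ _] [oJ3 _ _ _ _]] := (pX, pZ).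
have D (F : R -> R) J n x k (pF : profile J F) (Jx : J x) :=
  is_derive_along k (profile_is_derive n pF Jx).
have X0 := D _ _ 0%N _ 1 pX Ju; have X1 := D _ _ 1%N _ 1 pX Ju.
have Y0 := is_derive_cst (Y v) (0 : R) (1 : R).
have Y1 := is_derive_cst (derive1 Y v) (0 : R) (1 : R).
have Z0 := D _ _ 0%N _ (-1) pZ Jw; have Z1 := D _ _ 1%N _ (-1) pZ Jw.
have := is_derive_near0 _ (is_derive_add
  (is_derive_add (is_derive_mul X1 (is_derive_add Y0 Z0))
                 (is_derive_mul Y1 (is_derive_add X0 Z0)))
  (is_derive_mul Z1 (is_derive_add X0 Y0))).
rewrite /= !mulr0 !addr0 => H.
apply/eqP; rewrite -subr_eq0; apply/eqP; rewrite -[RHS]H; last first.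
  have n1 := open_near_affine 1 oJ1 Ju; have n3 := open_near_affine (-1) oJ3 Jw.
  apply: filterS2 n1 n3 => t Jut Jwt.
  by apply: (E _ _ _ Jut Jv Jwt); rewrite -[RHS]s; ring.
rewrite /derive1n/=.
move: (derive1 X u) (derive1 (derive1 X) u) (derive1 Y v) (derive1 Z w)
  (derive1 (derive1 Z) w) (X u) (Y v) (Z w) => *; ring.
Qed.

(** Second differentiation, now along [(u, v + t, w - t)]: the two [Y' Z''] terms cancel and a
    single third derivative remains. *)
Lemma minimal_eq_d2 (J1 J2 J3 : set R) (X Y Z : R -> R) u v w :
  profile J1 X -> profile J2 Y -> profile J3 Z -> minimal_eq J1 J2 J3 X Y Z ->
  J1 u -> J2 v -> J3 w -> u + v + w = 0 ->
  derive1n 3 Z w * (X u + Y v) + derive1n 2 X u * (derive1 Y v - derive1 Z w) +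
  derive1n 2 Y v * (derive1 X u - derive1 Z w) = 0.
Proof.
move=> pX pY pZ E Ju Jv Jw s.
have [[oJ2 _ _ _ _] [oJ3 _ _ _ _]] := (pY, pZ).
have D (F : R -> R) J n x k (pF : profile J F) (Jx : J x) :=
  is_derive_along k (profile_is_derive n pF Jx).
have X0 := is_derive_cst (X u) (0 : R) (1 : R).
have X1 := is_derive_cst (derive1 X u) (0 : R) (1 : R).
have X2 := is_derive_cst (derive1n 2 X u) (0 : R) (1 : R).
have Y0 := D _ _ 0%N _ 1 pY Jv; have Y1 := D _ _ 1%N _ 1 pY Jv.
have Z0 := D _ _ 0%N _ (-1) pZ Jw; have Z1 := D _ _ 1%N _ (-1) pZ Jw.
have Z2 := D _ _ 2%N _ (-1) pZ Jw.
have := is_derive_near0 _ (is_derive_add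
  (is_derive_add (is_derive_mul X2 (is_derive_add Y0 Z0)) (is_derive_mul X1 Y1))
  (is_derive_opp (is_derive_add (is_derive_mul Z2 (is_derive_add X0 Y0))
    (is_derive_mul Y1 Z1)))).
rewrite /= !mulr0 !addr0 => H.
rewrite -[RHS]H; last first.
  have n2 := open_near_affine 1 oJ2 Jv; have n3 := open_near_affine (-1) oJ3 Jw.
  apply: filterS2 n2 n3 => t Jvt Jwt.
  apply/eqP; rewrite subr_eq0; apply/eqP.
  by apply: (minimal_eq_d1 pX pY pZ E Ju Jvt Jwt); rewrite -[RHS]s; ring.
rewrite /derive1n/=.
move: (derive1 X u) (derive1 (derive1 X) u) (derive1 Y v)
  (derive1 (derive1 Y) v) (derive1 Z w) (derive1 (derive1 Z) w)
  (derive1 (derive1 (derive1 Z)) w) (X u) (Y v) (Z w) => *; ring.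
Qed.

End MinimalEq.

(* At a point, both quotients equal the same symmetric expression. *)
Lemma third_derivative_ratio (F : realFieldType)
    (x y z x1 y1 z1 x2 y2 z2 x3 y3 : F) :
  0 < x -> 0 < y -> 0 < z -> x1 != 0 -> y1 != 0 ->
  x1 * (y + z) + y1 * (x + z) + z1 * (x + y) = 0 ->
  x2 * (y + z) + x1 * y1 = z2 * (x + y) + y1 * z1 ->
  y2 * (x + z) + y1 * x1 = z2 * (y + x) + x1 * z1 ->
  x3 * (y + z) + y2 * (z1 - x1) + z2 * (y1 - x1) = 0 ->
  y3 * (x + z) + x2 * (z1 - y1) + z2 * (x1 - y1) = 0 ->
  x3 / x1 = y3 / y1.
Proof.
move=> x0 y0 z0 x10 y10 E T1 T2 A B.
have K0 : (y + z) * (x + z) * (x + y) != 0.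
  by rewrite !mulf_neq0// gt_eqF// addr_gt0.
(* By the two first-derivative relations, [z2 (x + y) - x1 y1] equals both [x2 (y + z) - y1 z1] and
   [y2 (x + z) - x1 z1], so [S] is symmetric in the three variables. *)
pose S := (z2 * (x + y) - x1 * y1) * (y + z + (x + z) + (x + y)) -
  (x1 ^+ 2 * (y + z) + y1 ^+ 2 * (x + z) + z1 ^+ 2 * (x + y)).
have rat a3 a1 : a1 != 0 -> a3 * ((y + z) * (x + z) * (x + y)) = a1 * S ->
    a3 / a1 = S / ((y + z) * (x + z) * (x + y)).
  by move=> a10 aS; apply/eqP; rewrite eqr_div// aS mulrC.
rewrite !rat//; rewrite /S; apply/eqP; rewrite -subr_eq0; apply/eqP.
(* With [K] the product of the three pairwise sums, [y3 K - y1 S] is a combination of the relations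
   [B], [T1] and [E]; the next goal is the same for [x3], with [A], [T2] and [E]. *)
- rewrite [LHS](_ : _ =
    (y3 * (x + z) + x2 * (z1 - y1) + z2 * (x1 - y1)) * ((y + z) * (x + y))
    - (x2 * (y + z) + x1 * y1 - (z2 * (x + y) + y1 * z1))
        * ((z1 - y1) * (x + y))
    - (x1 * (y + z) + y1 * (x + z) + z1 * (x + y))
        * (z2 * (x + y) - x1 * y1 - y1 ^+ 2)); last ring.
  by rewrite B E T1 subrr !mul0r !subr0.
- rewrite [LHS](_ : _ =
    (x3 * (y + z) + y2 * (z1 - x1) + z2 * (y1 - x1)) * ((x + z) * (x + y))
    - (y2 * (x + z) + y1 * x1 - (z2 * (y + x) + x1 * z1))
        * ((z1 - x1) * (x + y))
    - (x1 * (y + z) + y1 * (x + z) + z1 * (x + y))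
        * (z2 * (x + y) - x1 * y1 - x1 ^+ 2)); last ring.
  by rewrite A E T2 subrr !mul0r !subr0.
Qed.

(** A cyclic rotation of the variables puts the third derivative on [X]; the solutions of the ODE
    are substituted into this form. *)
Lemma minimal_eq_A (R : realType) (J1 J2 J3 : set R) (X Y Z : R -> R) u v w :
  profile J1 X -> profile J2 Y -> profile J3 Z -> minimal_eq J1 J2 J3 X Y Z ->
  J1 u -> J2 v -> J3 w -> u + v + w = 0 ->
  derive1n 3 X u * (Y v + Z w) + derive1n 2 Y v * (derive1 Z w - derive1 X u)
    + derive1n 2 Z w * (derive1 Y v - derive1 X u) = 0.
Proof.
move=> pX pY pZ E Ju Jv Jw s.
apply: (minimal_eq_d2 pY pZ pX) => //; last by rewrite -s addrC addrA.
exact/minimal_eq_swap23/minimal_eq_swap12.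
Qed.

Lemma minimal_eq_ratio (R : realType) (J1 J2 J3 : set R) (X Y Z : R -> R)
    u v w :
  profile J1 X -> profile J2 Y -> profile J3 Z -> minimal_eq J1 J2 J3 X Y Z ->
  J1 u -> J2 v -> J3 w -> u + v + w = 0 ->
  derive1n 3 X u / derive1 X u = derive1n 3 Y v / derive1 Y v.
Proof.
move=> pX pY pZ E Ju Jv Jw s.
have s' : v + u + w = 0 by rewrite [v + u]addrC.
have EY := minimal_eq_swap12 E.
case: (pX) (pY) (pZ) => _ _ _ X0 X1 [_ _ _ Y0 Y1] [_ _ _ Z0 _].
apply: (third_derivative_ratio (X0 _ Ju) (Y0 _ Jv) (Z0 _ Jw) (X1 _ Ju) (Y1 _ Jv)
  (E _ _ _ Ju Jv Jw s) (minimal_eq_d1 pX pY pZ E Ju Jv Jw s)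
  (minimal_eq_d1 pY pX pZ EY Jv Ju Jw s')
  (minimal_eq_A pX pY pZ E Ju Jv Jw s) (minimal_eq_A pY pX pZ EY Jv Ju Jw s')).
Qed.

Lemma open_attained (R : realType) (J1 J2 J3 : set R) :
  open J1 -> open J3 -> open (attained J1 J2 J3).
Proof.
move=> oJ1 oJ3; rewrite openE => u [Ju [v [w [Jv Jw s]]]].
have n1 : \forall t \near u, J1 t by exact: open_nbhs_nbhs.
have n3 : \forall t \near u, J3 (- v + (-1) * t).
  have [/derivable1_diffP/differentiable_continuous c _] :=
    is_derive_affine (- v) (-1) u.
  apply: c; apply: open_nbhs_nbhs; split => //.
  by rewrite (_ : _ + _ = w)//; lra.
apply: filterS2 n1 n3 => t Jt Jw'; split => //.
by exists v, (- v + (-1) * t); split => //; ring.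
Qed.

Lemma is_interval_convex (R : realType) (J : set R) (k x y : R) :
  is_interval J -> 0 <= k <= 1 -> J x -> J y -> J (x + k * (y - x)).
Proof.
move=> iJ /andP[k0 k1] Jx Jy; have [xy|yx] := leP x y.
  by apply: (iJ x y) => //; apply/andP; split; nra.
by apply: (iJ y x) => //; apply/andP; split; nra.
Qed.

(** The triples of [J1 x J2 x J3] with sum zero form a convex set, of which this is a projection.
    The witnesses are interpolated with the same parameter [k] as [t]. *)
Lemma is_interval_attained (R : realType) (J1 J2 J3 : set R) :
  is_interval J1 -> is_interval J2 -> is_interval J3 ->
  is_interval (attained J1 J2 J3).
Proof.
move=> i1 i2 i3 u u' [Ju [v [w [Jv Jw s]]]] [Ju' [v' [w' [Jv' Jw' s']]]] t.
move=> /andP[ut tu']; split; first by apply: (i1 u u') => //; rewrite ut.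
have [uu'|uu'] := eqVneq u u'.
  have -> : t = u by apply/le_anti; rewrite ut {1}uu' tu'.
  by exists v, w.
have uu'0 : 0 < u' - u by rewrite subr_gt0 lt_neqAle uu' (le_trans ut).
pose k := (t - u) / (u' - u).
have k01 : 0 <= k <= 1.
  by rewrite /k ler_pdivlMr// ler_pdivrMr// mul0r mul1r subr_ge0 ut lerB.
have tE : t = u + k * (u' - u) by rewrite /k divfK ?gt_eqF// addrC subrK.
exists (v + k * (v' - v)), (w + k * (w' - w)); split.
- exact: is_interval_convex.
- exact: is_interval_convex.
- have -> : t + (v + k * (v' - v)) + (w + k * (w' - w)) =
    (u + v + w) + k * ((u' + v' + w') - (u + v + w)) by rewrite {1}tE; ring.
  by rewrite s s' subrr mulr0 addr0.
Qed.

(** For a fixed v, all u near x can be completed by [w = - v - u], so the ratio equals [Y'''/Y'] at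
    that v: it is locally constant, hence constant on an interval. *)
Lemma minimal_eq_cst (R : realType) (J1 J2 J3 : set R) (X Y Z : R -> R) u u' :
  profile J1 X -> profile J2 Y -> profile J3 Z -> minimal_eq J1 J2 J3 X Y Z ->
  attained J1 J2 J3 u -> attained J1 J2 J3 u' ->
  derive1n 3 X u / derive1 X u = derive1n 3 X u' / derive1 X u'.
Proof.
move=> pX pY pZ E.
case: (pX) (pY) (pZ) => oJ1 iJ1 _ _ _ [_ iJ2 _ _ _] [oJ3 iJ3 _ _ _].
apply: (is_derive0_interval_cst (is_interval_attained iJ1 iJ2 iJ3)
  (F := fun u => derive1n 3 X u / derive1 X u)) => x [Jx [v [w [Jv Jw s]]]].
apply: (near_eq_is_derive1 _
  (is_derive_cst (derive1n 3 Y v / derive1 Y v : R) x (1 : R))).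
have n1 : \forall t \near x, J1 t by exact: open_nbhs_nbhs.
have n3 : \forall t \near x, J3 (- v + (-1) * t).
  have [/derivable1_diffP/differentiable_continuous c _] :=
    is_derive_affine (- v) (-1) x.
  apply: c; apply: open_nbhs_nbhs; split => //.
  by rewrite (_ : _ + _ = w)//; lra.
apply: filterS2 n1 n3 => t Jt Jw'.
by apply/esym/(minimal_eq_ratio pX pY pZ E Jt Jv Jw'); ring.
Qed.

(** * The linear equation X''' = a X' on an interval *)

Section LinearODE.
Context {R : realType} {U : set R} {X : R -> R} {u0 : R}.
Hypotheses (iU : is_interval U) (Uu0 : U u0).
Hypothesis dX : forall n u, U u ->
  is_derive u 1 (derive1n n X) (derive1n n.+1 X u).

Let const (F F' : R -> R) : (forall u, U u -> is_derive u 1 F (F' u)) ->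
  (forall u, U u -> F' u = 0) -> forall u, U u -> F u = F u0.
Proof.
move=> dF F0 u Uu; apply: (is_derive0_interval_cst iU) => // x Ux.
by rewrite -(F0 x Ux); exact: dF.
Qed.

Lemma ode_zero : (forall u, U u -> derive1n 3 X u = 0) ->
  exists p q r, forall u, U u ->
    [/\ X u = p + q * u + r * u ^+ 2, derive1 X u = q + 2 * r * u &
        derive1n 2 X u = 2 * r].
Proof.
move=> H.
pose r := derive1n 2 X u0 / 2.
have X2 u : U u -> derive1n 2 X u = 2 * r.
  by move=> Uu; rewrite (const (dX 2) H Uu) /r; field.
pose q := derive1 X u0 - 2 * r * u0.
have X1 u : U u -> derive1 X u = q + 2 * r * u.
  move=> Uu.
  have D x (Ux : U x) := is_derive_add (dX 1 Ux)
    (is_derive_opp (is_derive_linear (2 * r) x)).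
  have := const D _ Uu.
  have E x : U x -> derive1n 2 X x - 2 * r = 0 by move=> /X2 ->; rewrite subrr.
  move=> /(_ E)/eqP; rewrite subr_eq => /eqP X1u.
  by rewrite [LHS]X1u /q derive1n1; ring.
exists (X u0 - q * u0 - r * u0 ^+ 2), q, r => u Uu.
split; [|exact: X1|exact: X2].
have D x (Ux : U x) := is_derive_add (dX 0 Ux) (is_derive_opp
  (is_derive_add (is_derive_linear q x)
     (is_derive_mul (is_derive_cst r x (1 : R))
       (is_derive_exp 2 (is_derive_id x (1 : R)))))).
have E x : U x -> derive1 X x - (q + (0 * x ^+ 2 + r * (2 * x ^+ 1 * 1))) = 0.
  by move=> /X1 ->; ring.
have /eqP := const D E Uu; rewrite subr_eq => /eqP.
by rewrite /derive1n/= /cst/= => ->; ring.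
Qed.

Lemma ode_pos (b : R) : 0 < b ->
  (forall u, U u -> derive1n 3 X u = b ^+ 2 * derive1 X u) ->
  exists p q r, forall u, U u ->
    [/\ X u = p + q * expR (b * u) + r * expR (- (b * u)),
        derive1 X u = b * (q * expR (b * u) - r * expR (- (b * u))) &
        derive1n 2 X u = b ^+ 2 * (q * expR (b * u) + r * expR (- (b * u)))].
Proof.
move=> b0 H; have bn0 : b != 0 by rewrite gt_eqF.
have eP u := is_derive_comp (is_derive_expR (b * u)) (is_derive_linear b u).
have eN u := @is_derive_comp R expR (fun t => - (b * t)) u _ _
  (is_derive_expR (- (b * u))) (is_derive_opp (is_derive_linear b u)).
have ePN u : expR (- (b * u)) * expR (b * u) = 1 by rewrite mulrC expRxMexpNx_1.
(* The operator factors: [y = X'' + b X'] solves [y' = b y] and [X'' - b X'] solves [y' = - b y].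
   Multiplied by the opposite exponential, each is constant, and [alpha], [beta] are these
   constants. *)
pose alpha := (derive1n 2 X u0 + b * derive1 X u0) * expR (- (b * u0)).
pose beta := (derive1n 2 X u0 - b * derive1 X u0) * expR (b * u0).
have a_ u : U u -> derive1n 2 X u + b * derive1 X u = alpha * expR (b * u).
  move=> Uu.
  have D x (Ux : U x) := is_derive_mul (is_derive_add (dX 2 Ux)
    (is_derive_mul (is_derive_cst b x (1 : R)) (dX 1 Ux))) (eN x).
  have /(_ _ _ Uu) E := const D; rewrite -[alpha]E; first
    by rewrite -mulrA ePN mulr1.
  move=> x Ux; rewrite (H _ Ux) derive1n1 /cst.
  by move: (derive1 X x : R) (derive1n 2 X x : R) => y y2; ring.
have b_ u : U u -> derive1n 2 X u - b * derive1 X u = beta * expR (- (b * u)).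
  move=> Uu.
  have D x (Ux : U x) := is_derive_mul (is_derive_add (dX 2 Ux) (is_derive_opp
    (is_derive_mul (is_derive_cst b x (1 : R)) (dX 1 Ux)))) (eP x).
  have /(_ _ _ Uu) E := const D; rewrite -[beta]E; first
    by rewrite -mulrA [expR _ * _]mulrC ePN mulr1.
  move=> x Ux; rewrite (H _ Ux) derive1n1 /cst.
  by move: (derive1 X x : R) (derive1n 2 X x : R) => y y2; ring.
pose q := alpha / (2 * b ^+ 2); pose r := beta / (2 * b ^+ 2).
have X1 u : U u -> derive1 X u = b * (q * expR (b * u) - r * expR (- (b * u))).
  move=> Uu; have := a_ u Uu; have := b_ u Uu; rewrite /q /r.
  move: (derive1 X u : R) (derive1n 2 X u : R) => y y2 h1 h2.
  have -> : y = ((y2 + b * y) - (y2 - b * y)) / (2 * b) by field.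
  by rewrite h1 h2; field.
have X2 u : U u -> derive1n 2 X u =
    b ^+ 2 * (q * expR (b * u) + r * expR (- (b * u))).
  move=> Uu; have := a_ u Uu; have := b_ u Uu; rewrite /q /r.
  move: (derive1 X u : R) (derive1n 2 X u : R) => y y2 h1 h2.
  have -> : y2 = ((y2 + b * y) + (y2 - b * y)) / 2 by field.
  by rewrite h1 h2; field.
exists (X u0 - q * expR (b * u0) - r * expR (- (b * u0))), q, r => u Uu.
split; [|exact: X1|exact: X2].
have D x (Ux : U x) := is_derive_add (dX 0 Ux) (is_derive_opp
  (is_derive_add (is_derive_mul (is_derive_cst q x (1 : R)) (eP x))
                 (is_derive_mul (is_derive_cst r x (1 : R)) (eN x)))).
have /(_ _ _ Uu) E := const D.
rewrite -[LHS](subrK (q * expR (b * u) + r * expR (- (b * u)))) [X in X + _]E.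
  by rewrite /cst/derive1n/=; ring.
move=> x Ux; have -> : derive1n 1 X x = derive1 X x by [].
by rewrite (X1 _ Ux) /cst; ring.
Qed.

Lemma ode_neg (b : R) : 0 < b ->
  (forall u, U u -> derive1n 3 X u = - b ^+ 2 * derive1 X u) ->
  exists p q r, forall u, U u ->
    [/\ X u = p + q * cos (b * u) + r * sin (b * u),
        derive1 X u = b * (r * cos (b * u) - q * sin (b * u)) &
        derive1n 2 X u = - b ^+ 2 * (q * cos (b * u) + r * sin (b * u))].
Proof.
move=> b0 H; have bn0 : b != 0 by rewrite gt_eqF.
have dc u := is_derive_comp (is_derive_cos (b * u)) (is_derive_linear b u).
have ds u := is_derive_comp (is_derive_sin (b * u)) (is_derive_linear b u).
(* The vector [(X'', b X')] rotates at angular speed [b]; [alpha] and [- beta] are its constant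
   components in the frame rotating with it. *)
pose alpha := derive1n 2 X u0 * cos (b * u0) + b * derive1 X u0 * sin (b * u0).
pose beta := derive1n 2 X u0 * sin (b * u0) - b * derive1 X u0 * cos (b * u0).
have a_ u : U u ->
    derive1n 2 X u * cos (b * u) + b * derive1 X u * sin (b * u) = alpha.
  move=> Uu.
  have D x (Ux : U x) := is_derive_add (is_derive_mul (dX 2 Ux) (dc x))
    (is_derive_mul (is_derive_mul (is_derive_cst b x (1 : R)) (dX 1 Ux)) (ds x)).
  have /(_ _ _ Uu) := const D; apply.
  move=> x Ux; rewrite (H _ Ux) derive1n1 /cst.
  by move: (derive1 X x : R) (derive1n 2 X x : R) => y y2; ring.
have b_ u : U u ->
    derive1n 2 X u * sin (b * u) - b * derive1 X u * cos (b * u) = beta.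
  move=> Uu.
  have D x (Ux : U x) := is_derive_add (is_derive_mul (dX 2 Ux) (ds x))
    (is_derive_opp
      (is_derive_mul (is_derive_mul (is_derive_cst b x (1 : R)) (dX 1 Ux)) (dc x))).
  have /(_ _ _ Uu) := const D; apply.
  move=> x Ux; rewrite (H _ Ux) derive1n1 /cst.
  by move: (derive1 X x : R) (derive1n 2 X x : R) => y y2; ring.
pose q := - alpha / b ^+ 2; pose r := - beta / b ^+ 2.
have X1 u : U u -> derive1 X u = b * (r * cos (b * u) - q * sin (b * u)).
  move=> Uu; rewrite /q /r -(a_ u Uu) -(b_ u Uu).
  have := cos2Dsin2 (b * u).
  move: (derive1 X u : R) (derive1n 2 X u : R) (cos _) (sin _) => y y2 c s cs.
  by rewrite -[LHS]mulr1 -cs; field.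
have X2 u : U u -> derive1n 2 X u =
    - b ^+ 2 * (q * cos (b * u) + r * sin (b * u)).
  move=> Uu; rewrite /q /r -(a_ u Uu) -(b_ u Uu).
  have := cos2Dsin2 (b * u).
  move: (derive1 X u : R) (derive1n 2 X u : R) (cos _) (sin _) => y y2 c s cs.
  by rewrite -[LHS]mulr1 -cs; field.
exists (X u0 - q * cos (b * u0) - r * sin (b * u0)), q, r => u Uu.
split; [|exact: X1|exact: X2].
have D x (Ux : U x) := is_derive_add (dX 0 Ux) (is_derive_opp
  (is_derive_add (is_derive_mul (is_derive_cst q x (1 : R)) (dc x))
                 (is_derive_mul (is_derive_cst r x (1 : R)) (ds x)))).
have /(_ _ _ Uu) E := const D.
rewrite -[LHS](subrK (q * cos (b * u) + r * sin (b * u))) [X in X + _]E.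
  by rewrite /cst/derive1n/=; ring.
move=> x Ux; have -> : derive1n 1 X x = derive1 X x by [].
by rewrite (X1 _ Ux) /cst; ring.
Qed.

End LinearODE.

(** * Relations between the coefficients *)

(** The first two derivatives are kept with the solution, because [minimal_eq_A] involves all of
    them. *)
Definition exp_form {R : realType} (b p q r : R) (U : set R) (X : R -> R) :
    Prop :=
  forall u, U u ->
    [/\ X u = p + q * expR (b * u) + r * expR (- (b * u)),
        derive1 X u = b * (q * expR (b * u) - r * expR (- (b * u))) &
        derive1n 2 X u = b ^+ 2 * (q * expR (b * u) + r * expR (- (b * u)))].

Definition trig_form {R : realType} (b p q r : R) (U : set R) (X : R -> R) :
    Prop :=
  forall u, U u ->
    [/\ X u = p + q * cos (b * u) + r * sin (b * u),
        derive1 X u = b * (r * cos (b * u) - q * sin (b * u)) &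
        derive1n 2 X u = - b ^+ 2 * (q * cos (b * u) + r * sin (b * u))].

Definition quad_form {R : realType} (p q r : R) (U : set R) (X : R -> R) :
    Prop :=
  forall u, U u ->
    [/\ X u = p + q * u + r * u ^+ 2, derive1 X u = q + 2 * r * u &
        derive1n 2 X u = 2 * r].

(** The relation and its derivative at [u0] give [c e^(b u0)] as both equal and opposite to
    [d e^(- b u0)]. *)
Lemma exp_independent (R : realType) (U : set R) (b c d u0 : R) :
  open U -> U u0 -> b != 0 ->
  (forall u, U u -> c * expR (b * u) = d * expR (- (b * u))) -> c = 0 /\ d = 0.
Proof.
move=> oU Uu0 b0 H.
have eP := is_derive_comp (is_derive_expR (b * u0)) (is_derive_linear b u0).
have eN := @is_derive_comp R expR (fun t => - (b * t)) u0 _ _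
  (is_derive_expR (- (b * u0))) (is_derive_opp (is_derive_linear b u0)).
have := is_derive_near0 _ (is_derive_add
  (is_derive_mul (is_derive_cst c u0 (1 : R)) eP)
  (is_derive_opp (is_derive_mul (is_derive_cst d u0 (1 : R)) eN))).
have nU : \forall t \near u0, U t by exact: open_nbhs_nbhs.
have H0 := H _ Uu0.
have N : \forall t \near u0, c * expR (b * t) - d * expR (- (b * t)) = 0.
  by apply: filterS nU => t /H ->; rewrite subrr.
move=> /(_ N); rewrite /cst !mul0r !add0r => H1.
have e1 := expR_gt0 (b * u0); have e2 := expR_gt0 (- (b * u0)).
have S : b * (c * expR (b * u0) + d * expR (- (b * u0))) = 0.
  by rewrite -[RHS]H1; ring.
move: S; move/eqP; rewrite mulf_eq0 (negbTE b0)/= -H0 -mulr2n mulrn_eq0/=.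
rewrite mulf_eq0 (gt_eqF e1) orbF => /eqP c0; split=> //.
move: H0; rewrite c0 mul0r => /esym/eqP.
by rewrite mulf_eq0 (gt_eqF e2) orbF => /eqP.
Qed.

(** The relation and its derivative at [u0] form a linear system in [c], [d] with determinant of
    absolute value [cos^2 + sin^2 = 1]. *)
Lemma trig_independent (R : realType) (U : set R) (b c d u0 : R) :
  open U -> U u0 -> b != 0 ->
  (forall u, U u -> c * sin (b * u) = d * cos (b * u)) -> c = 0 /\ d = 0.
Proof.
move=> oU Uu0 b0 H.
have dc := is_derive_comp (is_derive_cos (b * u0)) (is_derive_linear b u0).
have ds := is_derive_comp (is_derive_sin (b * u0)) (is_derive_linear b u0).
have := is_derive_near0 _ (is_derive_add
  (is_derive_mul (is_derive_cst c u0 (1 : R)) ds)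
  (is_derive_opp (is_derive_mul (is_derive_cst d u0 (1 : R)) dc))).
have nU : \forall t \near u0, U t by exact: open_nbhs_nbhs.
have H0 := H _ Uu0.
have N : \forall t \near u0, c * sin (b * t) - d * cos (b * t) = 0.
  by apply: filterS nU => t /H ->; rewrite subrr.
move=> /(_ N); rewrite /cst !mul0r !add0r => H1.
have S : c * cos (b * u0) + d * sin (b * u0) = 0.
  by apply: (mulfI b0); rewrite mulr0 -[RHS]H1; ring.
have cs := cos2Dsin2 (b * u0).
split; rewrite -[LHS]mulr1 -cs.
- have -> : c * (cos (b * u0) ^+ 2 + sin (b * u0) ^+ 2) =
    (c * cos (b * u0) + d * sin (b * u0)) * cos (b * u0) +
    (c * sin (b * u0) - d * cos (b * u0)) * sin (b * u0) by ring.
  by rewrite S H0 subrr !mul0r addr0.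
- have -> : d * (cos (b * u0) ^+ 2 + sin (b * u0) ^+ 2) =
    (c * cos (b * u0) + d * sin (b * u0)) * sin (b * u0) -
    (c * sin (b * u0) - d * cos (b * u0)) * cos (b * u0) by ring.
  by rewrite S H0 subrr !mul0r subr0.
Qed.

Lemma attainedC23 (R : realType) (J1 J2 J3 : set R) :
  attained J1 J3 J2 = attained J1 J2 J3.
Proof.
by apply/seteqP; split=> u [Ju [v [w [Jv Jw s]]]]; split=> //;
  exists w, v; split=> //; rewrite addrAC.
Qed.

Lemma attained_rot (R : realType) (J1 J2 J3 : set R) u v w :
  J1 u -> J2 v -> J3 w -> u + v + w = 0 ->
  [/\ attained J1 J2 J3 u, attained J2 J1 J3 v & attained J3 J1 J2 w].
Proof.
move=> Ju Jv Jw s; split; split=> //.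
- by exists v, w.
- by exists u, w; split=> //; rewrite [v + u]addrC.
- by exists u, v; split=> //; rewrite -addrA addrC.
Qed.

Section Coefficients.
Context {R : realType} {J1 J2 J3 : set R} {X Y Z : R -> R}.
Hypotheses (pX : profile J1 X) (pY : profile J2 Y) (pZ : profile J3 Z).
Hypothesis E : minimal_eq J1 J2 J3 X Y Z.
Context {a u0 : R}.
Hypothesis Uu0 : attained J1 J2 J3 u0.
Hypothesis Xa : forall u, attained J1 J2 J3 u ->
  derive1n 3 X u = a * derive1 X u.
Context {p1 p2 p3 q1 q2 q3 r1 r2 r3 : R}.

Let oU : open (attained J1 J2 J3).
Proof. by case: pX pZ => oJ1 _ _ _ _ [oJ3 _ _ _ _]; exact: open_attained. Qed.

(** As [X''' = b^2 X'], [Y'' = b^2 (Y - p2)] and [Z'' = b^2 (Z - p3)], the terms of the relation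
    containing a derivative of X collapse to [b^2 (p2 + p3) X']. The rest, [Y'' Z' + Z'' Y'],
    depends on [v + w = - u] alone, so a relation in u only is left. *)
Lemma exp_form_coef (b : R) : 0 < b -> a = b ^+ 2 ->
  exp_form b p1 q1 r1 (attained J1 J2 J3) X ->
  exp_form b p2 q2 r2 (attained J2 J1 J3) Y ->
  exp_form b p3 q3 r3 (attained J3 J1 J2) Z ->
  (p2 + p3) * q1 - 2 * r2 * r3 = 0 /\ (p2 + p3) * r1 - 2 * q2 * q3 = 0.
Proof.
move=> b0 ab fX fY fZ; have bn0 : b != 0 by rewrite gt_eqF.
apply: (exp_independent oU Uu0 bn0) => u Uu.
have [Ju [v [w [Jv Jw s]]]] := Uu; have [_ Uv Uw] := attained_rot Ju Jv Jw s.
have := minimal_eq_A pX pY pZ E Ju Jv Jw s; rewrite (Xa Uu) ab.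
have [_ -> _] := fX _ Uu.
have [-> -> ->] := fY _ Uv; have [-> -> ->] := fZ _ Uw.
have ePu : expR (b * u) = expR (- (b * v)) * expR (- (b * w)).
  rewrite -expRD; congr expR; apply/eqP; rewrite -subr_eq0; apply/eqP.
  by rewrite -[RHS](mulr0 b) -s; ring.
have eNu : expR (- (b * u)) = expR (b * v) * expR (b * w).
  rewrite -expRD; congr expR; apply/eqP; rewrite -subr_eq0; apply/eqP.
  by rewrite -[RHS](mulr0 (- b)) -s; ring.
rewrite ePu eNu => A; apply/eqP; rewrite -subr_eq0; apply/eqP.
by apply: (mulfI (expf_neq0 3 bn0)); rewrite mulr0 -[RHS]A; ring.
Qed.

(** The same collapse occurs with [- b^2] for [b^2], and the addition formulas make
    [Y'' Z' + Z'' Y'] a function of [v + w]. *)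
Lemma trig_form_coef (b : R) : 0 < b -> a = - b ^+ 2 ->
  trig_form b p1 q1 r1 (attained J1 J2 J3) X ->
  trig_form b p2 q2 r2 (attained J2 J1 J3) Y ->
  trig_form b p3 q3 r3 (attained J3 J1 J2) Z ->
  (p2 + p3) * q1 - q2 * q3 + r2 * r3 = 0 /\
  (p2 + p3) * r1 + q2 * r3 + q3 * r2 = 0.
Proof.
move=> b0 ab fX fY fZ; have bn0 : b != 0 by rewrite gt_eqF.
apply: (trig_independent oU Uu0 bn0) => u Uu.
have [Ju [v [w [Jv Jw s]]]] := Uu; have [_ Uv Uw] := attained_rot Ju Jv Jw s.
have := minimal_eq_A pX pY pZ E Ju Jv Jw s; rewrite (Xa Uu) ab.
have [_ -> _] := fX _ Uu.
have [-> -> ->] := fY _ Uv; have [-> -> ->] := fZ _ Uw.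
have -> : b * u = - (b * v + b * w).
  apply/eqP; rewrite -subr_eq0; apply/eqP.
  by rewrite -[RHS](mulr0 b) -s; ring.
rewrite sinN cosN sinD cosD.
have := cos2Dsin2 (b * v); have := cos2Dsin2 (b * w).
move: (cos _) (sin _) (cos _) (sin _) => c3 s3 c2 s2 _ _ A.
apply/eqP; rewrite -subr_eq0; apply/eqP.
by apply: (mulfI (expf_neq0 3 bn0)); rewrite mulr0 -[RHS]A; ring.
Qed.

End Coefficients.

Section QuadraticCoefficients.
Context {R : realType} {J1 J2 J3 : set R} {X Y Z : R -> R}.
Hypotheses (pX : profile J1 X) (pY : profile J2 Y) (pZ : profile J3 Z).
Hypothesis E : minimal_eq J1 J2 J3 X Y Z.
Context {u0 : R}.
Hypothesis Uu0 : attained J1 J2 J3 u0.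
Hypothesis Xa : forall u, attained J1 J2 J3 u -> derive1n 3 X u = 0.
Context {p1 p2 p3 q1 q2 q3 r1 r2 r3 : R}.
Hypothesis fX : quad_form p1 q1 r1 (attained J1 J2 J3) X.
Hypothesis fY : quad_form p2 q2 r2 (attained J2 J1 J3) Y.
Hypothesis fZ : quad_form p3 q3 r3 (attained J3 J1 J2) Z.

(** With [X''' = 0] and [v + w = - u], the relation is affine in u; it vanishes on an open set, so
    its slope and its constant term vanish. *)
Lemma quad_form_coef23 :
  (q1 - q3) * r2 + (q1 - q2) * r3 = 0 /\ r1 * r2 + r1 * r3 + r2 * r3 = 0.
Proof.
have [oJ1 _ _ _ _] := pX; have [oJ3 _ _ _ _] := pZ.
have oU : open (attained J1 J2 J3) by exact: open_attained.
have H u : attained J1 J2 J3 u ->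
    (q1 - q3) * r2 + (q1 - q2) * r3 +
    (2 * (r1 * r2 + r1 * r3 + r2 * r3)) * u = 0.
  move=> Uu.
  have [Ju [v [w [Jv Jw s]]]] := Uu; have [_ Uv Uw] := attained_rot Ju Jv Jw s.
  have := minimal_eq_A pX pY pZ E Ju Jv Jw s; rewrite (Xa Uu).
  have [_ -> _] := fX Uu; have [-> -> ->] := fY Uv; have [-> -> ->] := fZ Uw.
  have -> : w = - (u + v) by apply/eqP; rewrite -addr_eq0 addrC s.
  move=> A; apply: (@mulfI R (- 2)); first by rewrite oppr_eq0 pnatr_eq0.
  by rewrite mulr0 -[RHS]A; ring.
have nU : \forall t \near u0, attained J1 J2 J3 t by exact: open_nbhs_nbhs.
have N : \forall t \near u0, (q1 - q3) * r2 + (q1 - q2) * r3 +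
    (2 * (r1 * r2 + r1 * r3 + r2 * r3)) * t = 0.
  by apply: filterS nU.
have /eqP := is_derive_near0 N (is_derive_affine _ _ u0).
rewrite mulf_eq0 pnatr_eq0/= => /eqP s0; split=> //.
by have := H _ Uu0; rewrite s0 mulr0 mul0r addr0.
Qed.

(** The premise is the first conclusion of [quad_form_coef23] with X and Y exchanged. Once the
    coefficients of degree two and three vanish, the derivatives at one point give the second and
    third relations, and the value there gives the first. *)
Lemma quad_form_coef :
  (q2 - q3) * r1 - (q1 - q2) * r3 = 0 ->
  [/\ (p2 + p3) * q1 + (p1 + p3) * q2 + (p1 + p2) * q3 = 0,
      2 * (p2 + p3) * r1 - 2 * (p1 + p2) * r3 + q2 * (q1 - q3) = 0 &
      2 * (p1 + p3) * r2 - 2 * (p1 + p2) * r3 + q1 * (q2 - q3) = 0].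
Proof.
move=> R4; have [R5 S] := quad_form_coef23.
have [Ju [v [w [Jv Jw s]]]] := Uu0; have [_ Uv Uw] := attained_rot Ju Jv Jw s.
have s' : v + u0 + w = 0 by rewrite [v + u0]addrC.
have := minimal_eq_d1 pY pX pZ (minimal_eq_swap12 E) Jv Ju Jw s'.
have := minimal_eq_d1 pX pY pZ E Ju Jv Jw s.
have := E Ju Jv Jw s.
have [-> -> ->] := fX Uu0; have [-> -> ->] := fY Uv; have [-> -> ->] := fZ Uw.
have -> : w = - (u0 + v) by apply/eqP; rewrite -addr_eq0 addrC s.
move=> E0 /eqP; rewrite -subr_eq0 => /eqP T1 /eqP; rewrite -subr_eq0 => /eqP T2.
(* With [w = - u - v], the equation is the cubic polynomial
   R1 + u R2 + v R3 + u^2 x4 + v^2 x5 + 2uv (x4 + x5) + 2uv(u + v) x6, where R1,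
   R2, R3 are the left-hand sides of the goal. *)
pose x4 := (q2 - q3) * r1 - (q1 - q2) * r3.
pose x5 := (q1 - q3) * r2 + (q1 - q2) * r3.
pose x6 := r1 * r2 + r1 * r3 + r2 * r3.
have R2 : 2 * (p2 + p3) * r1 - 2 * (p1 + p2) * r3 + q2 * (q1 - q3) = 0.
  transitivity (2 * u0 * x4 + 2 * v * (x4 + x5) + (4 * u0 * v + 2 * v ^+ 2) * x6
     + (2 * (p2 + p3) * r1 - 2 * (p1 + p2) * r3 + q2 * (q1 - q3))).
    by rewrite /x4 /x5 /x6 R4 R5 S addr0 !mulr0 !add0r.
  by rewrite -[RHS]T1 /x4 /x5 /x6; ring.
have R3 : 2 * (p1 + p3) * r2 - 2 * (p1 + p2) * r3 + q1 * (q2 - q3) = 0.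
  transitivity (2 * v * x5 + 2 * u0 * (x4 + x5) + (4 * u0 * v + 2 * u0 ^+ 2) * x6
     + (2 * (p1 + p3) * r2 - 2 * (p1 + p2) * r3 + q1 * (q2 - q3))).
    by rewrite /x4 /x5 /x6 R4 R5 S addr0 !mulr0 !add0r.
  by rewrite -[RHS]T2 /x4 /x5 /x6; ring.
split=> //.
transitivity ((p2 + p3) * q1 + (p1 + p3) * q2 + (p1 + p2) * q3
  + u0 * (2 * (p2 + p3) * r1 - 2 * (p1 + p2) * r3 + q2 * (q1 - q3))
  + v * (2 * (p1 + p3) * r2 - 2 * (p1 + p2) * r3 + q1 * (q2 - q3))
  + u0 ^+ 2 * x4 + v ^+ 2 * x5 + 2 * u0 * v * (x4 + x5)
  + 2 * u0 * v * (u0 + v) * x6).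
  by rewrite /x4 /x5 /x6 R2 R3 R4 R5 S addr0 !mulr0 !addr0.
by rewrite -[RHS]E0 /x4 /x5 /x6; ring.
Qed.

End QuadraticCoefficients.

Lemma minimal_eq_solution (R : realType) (J1 J2 J3 : set R) (X Y Z : R -> R) :
  profile J1 X -> profile J2 Y -> profile J3 Z -> minimal_eq J1 J2 J3 X Y Z ->
  attained J1 J2 J3 !=set0 ->
  let U := attained J1 J2 J3 in
  let V := attained J2 J1 J3 in
  let W := attained J3 J1 J2 in
  exists a : R,
    [/\ forall u, U u -> derive1n 3 X u / derive1 X u = a,
        forall v, V v -> derive1n 3 Y v / derive1 Y v = a
      & forall w, W w -> derive1n 3 Z w / derive1 Z w = a] /\
    exists p1 p2 p3 q1 q2 q3 r1 r2 r3 : R,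
    [/\ forall b : R, 0 < a -> 0 < b -> a = b ^+ 2 ->
          [/\ exp_form b p1 q1 r1 U X, exp_form b p2 q2 r2 V Y
            & exp_form b p3 q3 r3 W Z] /\
          [/\ (p2 + p3) * r1 - 2 * q2 * q3 = 0 /\ (p1 + p3) * r2 - 2 * q1 * q3 = 0,
              (p2 + p3) * q1 - 2 * r2 * r3 = 0 /\ (p1 + p3) * q2 - 2 * r1 * r3 = 0
            & (p1 + p2) * q3 - 2 * r1 * r2 = 0 /\ (p1 + p2) * r3 - 2 * q1 * q2 = 0],
        forall b : R, a < 0 -> 0 < b -> a = - b ^+ 2 ->
          [/\ trig_form b p1 q1 r1 U X, trig_form b p2 q2 r2 V Y
            & trig_form b p3 q3 r3 W Z] /\
          [/\ (p2 + p3) * q1 - q2 * q3 + r2 * r3 = 0 /\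
              (p2 + p3) * r1 + q2 * r3 + q3 * r2 = 0,
              (p1 + p3) * q2 - q1 * q3 + r1 * r3 = 0 /\
              (p1 + p3) * r2 + q1 * r3 + q3 * r1 = 0
            & (p1 + p2) * q3 - q1 * q2 + r1 * r2 = 0 /\
              (p1 + p2) * r3 + q1 * r2 + q2 * r1 = 0]
      & a = 0 ->
          [/\ quad_form p1 q1 r1 U X, quad_form p2 q2 r2 V Y
            & quad_form p3 q3 r3 W Z] /\
          [/\ (p2 + p3) * q1 + (p1 + p3) * q2 + (p1 + p2) * q3 = 0,
              2 * (p2 + p3) * r1 - 2 * (p1 + p2) * r3 + q2 * (q1 - q3) = 0 /\
              2 * (p1 + p3) * r2 - 2 * (p1 + p2) * r3 + q1 * (q2 - q3) = 0,
              (q2 - q3) * r1 - (q1 - q2) * r3 = 0,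
              (q1 - q3) * r2 + (q1 - q2) * r3 = 0
            & r1 * r2 + r1 * r3 + r2 * r3 = 0]].
Proof.
move=> pX pY pZ E [u0 Uu0] U V W.
have EY := minimal_eq_swap12 E.
have EZ := minimal_eq_swap12 (minimal_eq_swap23 E).
have [Ju0 [v0 [w0 [Jv0 Jw0 s0]]]] := Uu0.
have [_ Vv0 Ww0] := attained_rot Ju0 Jv0 Jw0 s0.
pose a := derive1n 3 X u0 / derive1 X u0.
have ra u : U u -> derive1n 3 X u / derive1 X u = a.
  by move=> Uu; exact: (minimal_eq_cst pX pY pZ E Uu Uu0).
have rb v : V v -> derive1n 3 Y v / derive1 Y v = a.
  move=> [Jv [u [w [Ju Jw s]]]].
  rewrite (minimal_eq_ratio pY pX pZ EY Jv Ju Jw s) ra//; split=> //.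
  by exists v, w; split=> //; rewrite [u + v]addrC.
have rc w : W w -> derive1n 3 Z w / derive1 Z w = a.
  move=> [Jw [u [v [Ju Jv s]]]].
  rewrite (minimal_eq_ratio pZ pX pY EZ Jw Ju Jv s) ra//; split=> //.
  by exists v, w; split=> //; rewrite addrC addrA.
(* From here the three variables play the same role, and only the value of [a] matters. *)
exists a; split=> //; clearbody a.
have Xa u : U u -> derive1n 3 X u = a * derive1 X u.
  move=> Uu; rewrite -(ra u Uu) divfK//.
  by case: pX Uu => _ _ _ _ X1 [/X1].
have Ya v : V v -> derive1n 3 Y v = a * derive1 Y v.
  move=> Vv; rewrite -(rb v Vv) divfK//.
  by case: pY Vv => _ _ _ _ Y1 [/Y1].
have Za w : W w -> derive1n 3 Z w = a * derive1 Z w.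
  move=> Ww; rewrite -(rc w Ww) divfK//.
  by case: pZ Ww => _ _ _ _ Z1 [/Z1].
have dX n u : U u -> is_derive u 1 (derive1n n X) (derive1n n.+1 X u).
  by case=> Ju _; exact: profile_is_derive pX Ju.
have dY n v : V v -> is_derive v 1 (derive1n n Y) (derive1n n.+1 Y v).
  by case=> Jv _; exact: profile_is_derive pY Jv.
have dZ n w : W w -> is_derive w 1 (derive1n n Z) (derive1n n.+1 Z w).
  by case=> Jw _; exact: profile_is_derive pZ Jw.
have [_ i1 _ _ _] := pX; have [_ i2 _ _ _] := pY; have [_ i3 _ _ _] := pZ.
have iU : is_interval U by exact: is_interval_attained.
have iV : is_interval V by exact: is_interval_attained.
have iW : is_interval W by exact: is_interval_attained.
(* The coefficient lemmas, applied to permuted triples, produce attained sets whose last two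
   arguments are swapped. *)
have UE : attained J1 J3 J2 = U by exact: attainedC23.
have VE : attained J2 J3 J1 = V by exact: attainedC23.
have WE : attained J3 J2 J1 = W by exact: attainedC23.
have [a0|a0|a0] := ltgtP a 0.
- have b0 : 0 < Num.sqrt (- a) by rewrite sqrtr_gt0 oppr_gt0.
  have ab : a = - Num.sqrt (- a) ^+ 2.
    by rewrite sqr_sqrtr ?opprK// oppr_ge0 ltW.
  move: (Num.sqrt _) b0 ab => b b0 ab.
  have [|p1 [q1 [r1 fX]]] := ode_neg iU Uu0 dX b0.
    by move=> u /Xa; rewrite ab.
  have [|p2 [q2 [r2 fY]]] := ode_neg iV Vv0 dY b0.
    by move=> u /Ya; rewrite ab.
  have [|p3 [q3 [r3 fZ]]] := ode_neg iW Ww0 dZ b0.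
    by move=> u /Za; rewrite ab.
  exists p1, p2, p3, q1, q2, q3, r1, r2, r3; split.
  + by [].
  + move=> b' _ b'0 ab'.
    (* The conclusion is for any positive [b'] with [a = - b'^2]; it can only be the square root
       used to solve the ODE. *)
    have -> : b' = b.
      apply/eqP; rewrite -(eqrXn2 (n := 2))// ?ltW//.
      by apply/eqP/oppr_inj; rewrite -ab.
    split=> //.
    have [c1 d1] := trig_form_coef pX pY pZ E Uu0 Xa b0 ab fX fY fZ.
    have fX' : trig_form b p1 q1 r1 (attained J1 J3 J2) X by rewrite UE.
    have fY' : trig_form b p2 q2 r2 (attained J2 J3 J1) Y by rewrite VE.
    have fZ' : trig_form b p3 q3 r3 (attained J3 J2 J1) Z by rewrite WE.
    have [c2 d2] := trig_form_coef pY pX pZ EY Vv0 Ya b0 ab fY fX fZ'.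
    have [c3 d3] := trig_form_coef pZ pX pY EZ Ww0 Za b0 ab fZ fX' fY'.
    by split; split.
  + by move=> h; move: a0; rewrite h ltxx.
- have b0 : 0 < Num.sqrt a by rewrite sqrtr_gt0.
  have ab : a = Num.sqrt a ^+ 2 by rewrite sqr_sqrtr// ltW.
  move: (Num.sqrt _) b0 ab => b b0 ab.
  have [|p1 [q1 [r1 fX]]] := ode_pos iU Uu0 dX b0.
    by move=> u /Xa; rewrite ab.
  have [|p2 [q2 [r2 fY]]] := ode_pos iV Vv0 dY b0.
    by move=> u /Ya; rewrite ab.
  have [|p3 [q3 [r3 fZ]]] := ode_pos iW Ww0 dZ b0.
    by move=> u /Za; rewrite ab.
  exists p1, p2, p3, q1, q2, q3, r1, r2, r3; split.
  + move=> b' _ b'0 ab'.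
    have -> : b' = b by apply/eqP; rewrite -(eqrXn2 (n := 2))// ?ltW// -ab' -ab.
    split=> //.
    have [c1 d1] := exp_form_coef pX pY pZ E Uu0 Xa b0 ab fX fY fZ.
    have fX' : exp_form b p1 q1 r1 (attained J1 J3 J2) X by rewrite UE.
    have fY' : exp_form b p2 q2 r2 (attained J2 J3 J1) Y by rewrite VE.
    have fZ' : exp_form b p3 q3 r3 (attained J3 J2 J1) Z by rewrite WE.
    have [c2 d2] := exp_form_coef pY pX pZ EY Vv0 Ya b0 ab fY fX fZ'.
    have [c3 d3] := exp_form_coef pZ pX pY EZ Ww0 Za b0 ab fZ fX' fY'.
    by split; split.
  + by [].
  + by move=> h; move: a0; rewrite h ltxx.
- have Xa0 u : U u -> derive1n 3 X u = 0 by move=> /Xa; rewrite a0 mul0r.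
  have Ya0 u : V u -> derive1n 3 Y u = 0 by move=> /Ya; rewrite a0 mul0r.
  have Za0 u : W u -> derive1n 3 Z u = 0 by move=> /Za; rewrite a0 mul0r.
  have [p1 [q1 [r1 fX]]] := ode_zero iU Uu0 dX Xa0.
  have [p2 [q2 [r2 fY]]] := ode_zero iV Vv0 dY Ya0.
  have [p3 [q3 [r3 fZ]]] := ode_zero iW Ww0 dZ Za0.
  exists p1, p2, p3, q1, q2, q3, r1, r2, r3; split; [by []|by []|move=> _].
  split=> //.
  have [c5 c6] := quad_form_coef23 pX pY pZ E Uu0 Xa0 fX fY fZ.
  have fZ' : quad_form p3 q3 r3 (attained J3 J2 J1) Z by rewrite WE.
  have [c4 _] := quad_form_coef23 pY pX pZ EY Vv0 Ya0 fY fX fZ'.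
  have {}c4 : (q2 - q3) * r1 - (q1 - q2) * r3 = 0 by rewrite -[RHS]c4; ring.
  by have [c1 c2 c3] := quad_form_coef pX pY pZ E Uu0 Xa0 fX fY fZ c4.
Qed.

(** * Tangent planes and the Birkhoff-Gauss map *)

Lemma is_derive_coord (R : realType) (c : R -> 'rV[R]_3) (v : 'rV[R]_3)
    (t : R) i :
  is_derive t 1 c v -> is_derive t 1 (fun s => c s 0 i) (v 0 i).
Proof.
move=> [dc <-]; apply: DeriveDef; first by move/derivable_mxP : dc; exact.
by rewrite derive_mx// mxE.
Qed.

Lemma is_derive_bigsum (R : realType) (f : 'I_3 -> R -> R) (a : 'I_3 -> R)
    (t : R) :
  (forall i, is_derive t 1 (f i) (a i)) ->
  is_derive t 1 (fun s => \sum_i f i s) (\sum_i a i).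
Proof.
move=> fa; have := is_derive_sum fa.
by rewrite (_ : \sum_i f i = fun s => \sum_i f i s)//;
  apply/funext => s; rewrite fct_sumE.
Qed.

Lemma derivable_upto_affine (R : realType) (O J : set R) (n : nat)
    (F : R -> R) (u s : R) :
  open O -> (forall t, O t -> J (u + s * t)) -> derivable_upto n J F ->
  derivable_upto n O (fun t => F (u + s * t)).
Proof.
move=> oO OJ; elim: n F => [//|n IH] F [dF sF].
have D t : O t -> is_derive t 1 (fun t => F (u + s * t))
    (derive1 F (u + s * t) * s).
  move=> Ot; apply: is_derive_comp; last exact: is_derive_affine.
  exact/derivable_is_derive/dF/OJ.
apply: derivable_uptoS D _ => //.
apply: derivable_uptoM => //; first exact: IH.
exact: derivable_upto_cst.
Qed.

Lemma tangent_plane_is_derive (R : realType) (A : set 'rV[R]_3)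
    (p v : 'rV[R]_3) :
  tangent_plane A p v -> exists c : R -> 'rV[R]_3,
    [/\ \forall t \near (0 : R), A (c t), c 0 = p & is_derive (0 : R) 1 c v].
Proof.
move=> [c [Ac c0 c'0]]; exists c; split=> //.
  by apply: filterS Ac => t [].
have [_ /(_ 0%N) dc] := nbhs_singleton Ac.
by rewrite -c'0; exact: derivable_is_derive.
Qed.

(** Differentiation of [Phi (c t) = 1], divided by [2m]: velocities are orthogonal to the gradient
    of [Phi]. *)
Lemma tangent_plane_sphere (R : realType) (m : nat) (e v : 'rV[R]_3) :
  (0 < m)%N ->
  tangent_plane (unit_sphere m) e v -> \sum_i e 0 i ^+ (2 * m - 1) * v 0 i = 0.
Proof.
move=> m0 /tangent_plane_is_derive[c [Sc c0 cv]].
have m2 : (2 * m)%:R != 0 :> R by rewrite pnatr_eq0 muln_eq0/= -lt0n.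
apply: (mulfI m2); rewrite mulr0.
have D i := is_derive_exp (2 * m) (is_derive_coord i cv).
have := is_derive_near0 _ (is_derive_add (is_derive_bigsum D)
   (is_derive_cst (- 1 : R) (0 : R) (1 : R))).
rewrite /cst addr0 c0 => H.
rewrite -[RHS]H.
  by rewrite big_distrr/=; apply: eq_bigr => i _; rewrite mulrA subn1.
by apply: filterS Sc => t /= ScT; rewrite -/(Phi m (c t)) ScT subrr.
Qed.

Lemma odd_root_cross (R : realType) (k : nat) (a b x y : R) : odd k ->
  a ^+ k * y = b ^+ k * x -> a * odd_root k y = b * odd_root k x.
Proof.
move=> ok E.
rewrite -[LHS](odd_root_expK _ ok) -[RHS](odd_root_expK _ ok).
by rewrite (exprMn k a) (exprMn k b) (exp_odd_rootK y ok)
  (exp_odd_rootK x ok) E.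
Qed.

Section Surface.
Context {R : realType} {I : 'I_3 -> set R} {F : 'I_3 -> R -> R}.
Hypotheses (oI : forall i, open (I i)) (iI : forall i, is_interval (I i)).
Hypothesis sF : forall i, smooth_on (I i) (F i).
Hypothesis F'_neq0 : forall i t, I i t -> derive1 (F i) t != 0.

(** The separable surface with its coordinates indexed by ['I_3], so that the three are treated
    uniformly. *)
Let M := [set x : 'rV[R]_3 | (forall i, I i (x 0 i)) /\ \sum_i F i (x 0 i) = 0].

Let dF i t : I i t -> derivable (F i) t 1.
Proof. by move=> /(sF (i := i)) /(_ 0%N). Qed.

Lemma tangent_plane_sub (p v : 'rV[R]_3) : M p -> tangent_plane M p v ->
  \sum_i derive1 (F i) (p 0 i) * v 0 i = 0.
Proof.
move=> [Ip _] /tangent_plane_is_derive[c [Mc c0 cv]].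
have D i : is_derive (0 : R) 1 (fun s => F i (c s 0 i))
    (derive1 (F i) (p 0 i) * v 0 i).
  apply: is_derive_comp (is_derive_coord i cv).
  by rewrite c0; exact/derivable_is_derive/dF.
apply: is_derive_near0 (is_derive_bigsum D).
by apply: filterS Mc => t [].
Qed.

(** In the coordinates [F_i (x_i)] the surface is a piece of the plane of sum zero. The curve is a
    straight line there, with slopes [s i] that add up to zero; pulled back by the local inverses,
    its velocity is [s i / F_i' = v_i]. *)
Lemma tangent_plane_sup (p v : 'rV[R]_3) : M p ->
  \sum_i derive1 (F i) (p 0 i) * v 0 i = 0 -> tangent_plane M p v.
Proof.
move=> [Ip sp] nv; pose s i := derive1 (F i) (p 0 i) * v 0 i.
pose J i := F i @` I i.
have dFi i t : I i t -> derivable (F i) t 1 by exact: dF.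
have F'i i t : I i t -> derive1 (F i) t != 0 by exact: F'_neq0.
have gK i t : I i t -> local_inverse (I i) (F i) (F i t) = t.
  by move=> It; exact: (local_inverseK (@iI i) (@dFi i) (@F'i i) It).
have oJ i : open (J i).
  exact: (open_image_interval (@oI i) (@iI i) (@dFi i) (@F'i i)).
have sg i n : derivable_upto n (J i) (local_inverse (I i) (F i)).
  apply: (derivable_upto_pushforward (@oI i) (@iI i) (@dFi i) (@F'i i)
    _ (@gK i) (derivable_upto_id (@oI i) n)).
  by move=> k; have /smooth_onE := @sF i.
have : \forall t \near (0 : R), forall i, J i (F i (p 0 i) + s i * t).
  have N i : \forall t \near (0 : R), J i (F i (p 0 i) + s i * t).
    by apply: open_near_affine => //; exists (p 0 i).
  exact: (filter_forall (nbhs_filter (0 : R)) N).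
rewrite /prop_near1 nbhsE => -[T [oT T0] TJ].
pose c t := \row_i local_inverse (I i) (F i) (F i (p 0 i) + s i * t) : 'rV[R]_3.
exists c; split.
- apply: filterS (open_nbhs_nbhs (conj oT T0)) => t Tt; split.
    have Jt i := TJ t Tt i; split.
      by move=> i; rewrite mxE; have [x Ix <-] := Jt i; rewrite gK.
    transitivity (\sum_i (F i (p 0 i) + s i * t)).
      by apply: eq_bigr => i _; rewrite mxE; have [x Ix <-] := Jt i; rewrite gK.
    by rewrite big_split/= sp add0r -mulr_suml nv mul0r.
  suff : smooth_on T c by move=> /(_ t Tt).
  apply/smooth_onE => n; apply: derivable_upto_row => // i.
  by apply: derivable_upto_affine (sg i n) => // x Tx; exact: TJ.
- by apply/rowP => i; rewrite mxE mulr0 addr0 gK.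
- apply: is_derive_derive1.
  have -> : v = \row_i ((derive1 (F i) (p 0 i))^-1 * s i).
    by apply/rowP => i; rewrite mxE mulKf// F'_neq0.
  apply: is_derive_row => i; apply: is_derive_along.
  exact: (is_derive_local_inverse (@oI i) (@iI i) (@dFi i) (@F'i i) (Ip i)).
Qed.

Context {m : nat}.
Hypothesis m2 : (2 <= m)%N.

Let nu i t := odd_root (2 * m - 1) (derive1 (F i) t).

(** The vector [n_j e_i - n_i e_j] is tangent to M, hence to the sphere at [e], which gives
    [e_i^(2m-1) n_j = e_j^(2m-1) n_i]; it remains to take odd roots. *)
Lemma birkhoff_normal (p e : 'rV[R]_3) i j : M p -> unit_sphere m e ->
  birkhoff_orthogonal m e (tangent_plane M p) ->
  e 0 i * nu j (p 0 j) = e 0 j * nu i (p 0 i).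
Proof.
move=> Mp Se [_]; rewrite /norm2m Se powR1 invr1 scale1r => TS.
have [->//|ij] := eqVneq i j.
pose n k := derive1 (F k) (p 0 k).
pose v : 'rV[R]_3 := n j *: delta_mx 0 i - n i *: delta_mx 0 j.
have sumv (w : 'I_3 -> R) : \sum_k w k * v 0 k = w i * n j - w j * n i.
  rewrite (bigD1 i)//= (bigD1 j)/=; last by rewrite eq_sym.
  rewrite big1 => [|k /andP[ki kj]].
    by rewrite !mxE !eqxx [j == i]eq_sym (negbTE ij)/=; ring.
  by rewrite !mxE (negbTE ki) (negbTE kj) !andbF !mulr0 subr0 mulr0.
have : tangent_plane M p v.
  by apply: tangent_plane_sup => //; rewrite (sumv n); ring.
rewrite -TS => /(tangent_plane_sphere (ltnW m2)).
rewrite (sumv (fun k => e 0 k ^+ (2 * m - 1))) => /eqP.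
rewrite subr_eq0 => /eqP E.
exact: odd_root_cross (odd_2nB1 (ltnW m2)) E.
Qed.

End Surface.

(* [1 - n nu / (nu n)] projects row vectors onto [ker n] along [nu]. *)
Lemma trace_on_hyperplane (K : fieldType) (B : 'M[K]_(2, 3)) (A : 'M[K]_2)
    (D : 'M[K]_3) (n : 'cV[K]_3) (nu : 'rV[K]_3) (k s : K) :
  row_free B -> (forall v : 'rV[K]_3, (v <= B)%MS = (v *m n == 0)) ->
  nu *m n = s%:M -> s != 0 ->
  A *m B = k *: (B *m D *m (1%:M - s^-1 *: (n *m nu))) ->
  \tr A = k * \tr (D *m (1%:M - s^-1 *: (n *m nu))).
Proof.
move=> fB kerB nun s0; set Q := 1%:M - _ => AB.
have Qn : Q *m n = 0.
  rewrite mulmxBl mul1mx -scalemxAl -mulmxA nun mul_mx_scalar scalerA mulVf//.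
  by rewrite scale1r subrr.
have BQ : B *m Q = B.
  have Bn : B *m n = 0.
    apply/row_matrixP => i; rewrite row_mul row0; apply/eqP.
    by rewrite -kerB row_sub.
  by rewrite mulmxBr mulmx1 -scalemxAr mulmxA Bn mul0mx scaler0 subr0.
(* [Q] factors as [W *m B] with [B *m W = 1]. Hence [tr A = tr (A B W)], and cyclicity brings [W]
   and [B] together again as [Q]. *)
have /submxP[W QW] : (Q <= B)%MS.
  by apply/row_subP => i; rewrite kerB -row_mul Qn row0.
have BW : B *m W = 1%:M.
  by apply: (row_free_inj fB); rewrite mul1mx -mulmxA -QW.
have QQ : Q *m Q = Q by rewrite {1}QW -mulmxA BQ -QW.
rewrite -[A]mulmx1 -BW mulmxA AB -scalemxAl mxtraceZ; congr (_ * _).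
by rewrite -!mulmxA mxtrace_mulC -!mulmxA -QW QQ.
Qed.

(* A vector [x] of [ker n] congruent to [k w] modulo [nu] is the projection of
   [k w] onto [ker n] along [nu]. *)
Lemma projection_coord (K : fieldType) (n nu x w : 'I_3 -> K) (k s : K)
    (i : 'I_3) :
  s = \sum_j n j * nu j -> s != 0 -> \sum_j n j * x j = 0 ->
  (forall j, x i * nu j - x j * nu i = k * nu j * w i - k * nu i * w j) ->
  x i = k * (w i - s^-1 * (\sum_j n j * w j) * nu i).
Proof.
move=> sE s0 nx xw; apply: (mulfI s0).
(* The relations are summed over [j] with weights [n j]; since [x] is in the kernel of [n], the left
   side becomes [s x_i]. *)
transitivity (\sum_j n j * (x i * nu j - x j * nu i)).
  transitivity (x i * s - nu i * \sum_j n j * x j).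
    by rewrite nx mulr0 subr0 mulrC.
  by rewrite sE !mulr_sumr -sumrB; apply: eq_bigr => j _; ring.
transitivity (k * w i * s - k * nu i * \sum_j n j * w j); last by field.
rewrite [in RHS]sE !mulr_sumr -sumrB; apply: eq_bigr => j _.
by rewrite xw; ring.
Qed.

Lemma is_derive_diff_curve (R : realType) (eta : 'rV[R]_3 -> 'rV[R]_3)
    (c : R -> 'rV[R]_3) (v : 'rV[R]_3) :
  differentiable eta (c 0) -> is_derive (0 : R) 1 c v ->
  is_derive (0 : R) 1 (eta \o c) ('d eta (c 0) v).
Proof.
move=> de [dc cv].
have dc' : differentiable c 0 by exact/derivable1_diffP.
have D : differentiable (eta \o c) 0 by exact: differentiable_comp.
apply: DeriveDef; first exact/derivable1_diffP.
by rewrite deriveE// diff_comp//= -cv [in RHS]deriveE.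
Qed.

Section MinimalSurface.
Context {R : realType} {I : 'I_3 -> set R} {F : 'I_3 -> R -> R}.
Hypotheses (oI : forall i, open (I i)) (iI : forall i, is_interval (I i)).
Hypothesis sF : forall i, smooth_on (I i) (F i).
Hypothesis F'_neq0 : forall i t, I i t -> derive1 (F i) t != 0.
Context {m : nat}.
Hypothesis m2 : (2 <= m)%N.

Let M := [set x : 'rV[R]_3 | (forall i, I i (x 0 i)) /\ \sum_i F i (x 0 i) = 0].
Let nu i t := odd_root (2 * m - 1) (derive1 (F i) t).

Context {dnu : 'I_3 -> R -> R}.
Hypothesis dnuE : forall i t, I i t -> is_derive t 1 (nu i) (dnu i t).

Context {p : 'rV[R]_3} {eta : 'rV[R]_3 -> 'rV[R]_3}.
Hypotheses (Mp : M p) (bg : birkhoff_gauss_near m M eta p).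

(** The cross form of proportionality between [eta] and [nu], differentiated along a curve of M with
    velocity [v]. *)
Let d_eta_relation (v : 'rV[R]_3) i j : tangent_plane M p v ->
  'd eta p v 0 i * nu j (p 0 j) - 'd eta p v 0 j * nu i (p 0 i) =
  eta p 0 j * (dnu i (p 0 i) * v 0 i) - eta p 0 i * (dnu j (p 0 j) * v 0 j).
Proof.
move=> /tangent_plane_is_derive[c [Mc c0 cv]].
have [Ip _] := Mp.
have [s3 _] := nbhs_singleton bg.
have de : differentiable eta (c 0) by rewrite c0; exact: (s3 [::]).
have ec := is_derive_diff_curve de cv; rewrite c0 in ec.
have nuc k : is_derive (0 : R) 1 (fun t => nu k (c t 0 k))
    (dnu k (p 0 k) * v 0 k).
  by apply: is_derive_comp (is_derive_coord k cv); rewrite c0; exact: dnuE.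
have cc : c @ (0 : R) --> p.
  rewrite -c0.
  by have [/derivable1_diffP/differentiable_continuous] := cv.
(* The Gauss map property holds near [p], and the curve stays there for small t by continuity. *)
have bgc : \forall t \near (0 : R), M (c t) ->
    unit_sphere m (eta (c t)) /\
    birkhoff_orthogonal m (eta (c t)) (tangent_plane M (c t)).
  have bgt : \forall t \near (0 : R), (fun q => smooth3_at eta q /\
      (M q -> unit_sphere m (eta q) /\
        birkhoff_orthogonal m (eta q) (tangent_plane M q))) (c t).
    exact: cc _ bg.
  by apply: (filterS _ bgt) => t [].
have N : \forall t \near (0 : R),
    (eta \o c) t 0 i * nu j (c t 0 j) - (eta \o c) t 0 j * nu i (c t 0 i) = 0.
  have FF := nbhs_filter (0 : R).
  apply: (filterS _ (filterI Mc bgc)) => t [Mct /(_ Mct)[Se Be]].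
  apply/eqP; rewrite subr_eq0; apply/eqP.
  exact: (birkhoff_normal oI iI sF F'_neq0 m2 i j Mct Se Be).
have := is_derive_near0 N (is_derive_add
  (is_derive_mul (is_derive_coord i ec) (nuc j))
  (is_derive_opp (is_derive_mul (is_derive_coord j ec) (nuc i)))).
rewrite /= c0 => H; apply/eqP; rewrite -subr_eq0; apply/eqP.
rewrite -[RHS]H.
move: ('d eta p v 0 i) ('d eta p v 0 j) (eta p 0 i) (eta p 0 j) => x y z t.
by move: (nu i _) (nu j _) (dnu i _) (dnu j _) => a b d e; ring.
Qed.

Let n : 'cV[R]_3 := \col_j derive1 (F j) (p 0 j).
Let nuv : 'rV[R]_3 := \row_j nu j (p 0 j).
Let D : 'M[R]_3 := diag_mx (\row_j dnu j (p 0 j)).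
Let S : R := \sum_j derive1 (F j) (p 0 j) * nu j (p 0 j).

Let mulmx_n (v : 'rV[R]_3) :
  v *m n = (\sum_j derive1 (F j) (p 0 j) * v 0 j)%:M.
Proof.
apply/matrixP => i j; rewrite !mxE !ord1 eqxx mulr1n.
by apply: eq_bigr => k _; rewrite mxE mulrC.
Qed.

Let nu_neq0 i : nu i (p 0 i) != 0.
Proof.
have [Ip _] := Mp.
exact: odd_root_neq0 (odd_2nB1 (ltnW m2)) (F'_neq0 (Ip i)).
Qed.

Let eta_parallel : exists2 k, k != 0 & forall i, eta p 0 i = k * nu i (p 0 i).
Proof.
have [_ /(_ Mp)[Se Be]] := nbhs_singleton bg.
pose k := eta p 0 0 / nu 0 (p 0 0).
have E i : eta p 0 i = k * nu i (p 0 i).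
  rewrite /k mulrAC.
  rewrite -(birkhoff_normal oI iI sF F'_neq0 m2 i 0 Mp Se Be).
  by rewrite mulfK// nu_neq0.
exists k => //; apply/eqP => k0; move: Se; rewrite /unit_sphere/= /Phi.
rewrite big1 => [/esym/eqP|i _]; first by rewrite oner_eq0.
by rewrite E k0 mul0r expr0n muln_eq0/= -leqn0 leqNgt (ltn_trans _ m2).
Qed.

(** The projection along [nu] has diagonal entries [1 - n_i nu_i / S], so the stated sum is [S]
    times the trace of [D] followed by it. The mean curvature is half of [k] times that trace, with
    [k] nonzero. *)
Lemma minimal_surface_eq : S != 0 -> mean_curvature M eta p 0 ->
  \sum_i dnu i (p 0 i) * (S - derive1 (F i) (p 0 i) * nu i (p 0 i)) = 0.
Proof.
move=> S0 [t [[B [A [fB PB LB tA]]] /esym/eqP]].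
rewrite mulf_eq0 invr_eq0 pnatr_eq0/= => /eqP t0.
have [k k0 ek] := eta_parallel.
have inB (v : 'rV[R]_3) : tangent_plane M p v <-> (v <= B)%MS by rewrite PB.
have inT (v : 'rV[R]_3) : tangent_plane M p v <-> v *m n = 0.
  rewrite mulmx_n; split.
    by move=> /(tangent_plane_sub sF Mp) ->; rewrite raddf0.
  move=> /matrixP/(_ 0 0); rewrite !mxE eqxx mulr1n.
  exact: (tangent_plane_sup oI iI sF F'_neq0 Mp).
have kerB (v : 'rV[R]_3) : (v <= B)%MS = (v *m n == 0).
  by apply/idP/eqP => [/inB/inT|/inT/inB].
have nun : nuv *m n = S%:M.
  by rewrite mulmx_n; congr (_%:M); apply: eq_bigr => j _; rewrite mxE.
have AB : A *m B = k *: (B *m D *m (1%:M - S^-1 *: (n *m nuv))).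
  apply/row_matrixP => r; rewrite -LB; set v := row r B.
  have Tv : tangent_plane M p v by apply/inB; exact: row_sub.
  (* [d eta p] maps the plane into itself, as its values on the basis are combinations of the rows
     of [B]; this lets [projection_coord] identify [d eta p v]. *)
  have TLv : \sum_j derive1 (F j) (p 0 j) * 'd eta p v 0 j = 0.
    have : 'd eta p v *m n = 0.
      by apply/inT/inB; rewrite LB row_mul submxMl.
    by rewrite mulmx_n => /matrixP/(_ 0 0); rewrite !mxE eqxx mulr1n.
  have -> : row r (k *: (B *m D *m (1%:M - S^-1 *: (n *m nuv)))) =
      k *: (v *m D - S^-1 *: (v *m D *m n *m nuv)).
    by rewrite linearZ/= !row_mul -/v mulmxBr mulmx1 -scalemxAr !mulmxA.
  rewrite (mulmx_n (v *m D)) mul_scalar_mx scalerA.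
  have vD j : (v *m D) 0 j = dnu j (p 0 j) * v 0 j.
    by rewrite mul_mx_diag !mxE mulrC.
  move: (v *m D) vD => w wE; apply/rowP => i; rewrite !mxE wE.
  rewrite -wE; apply: (projection_coord (x := fun j => 'd eta p v 0 j)
    (nu := fun j => nu j (p 0 j)) (w := fun j => w 0 j) erefl S0 TLv) => j.
  by rewrite d_eta_relation// !ek !wE.
have := trace_on_hyperplane fB kerB nun S0 AB.
rewrite -tA t0 => /esym/eqP; rewrite mulf_eq0 (negbTE k0)/= => /eqP trD.
transitivity (S * \tr (D *m (1%:M - S^-1 *: (n *m nuv)))); last first.
  by rewrite trD mulr0.
rewrite mulr_sumr; apply: eq_bigr => i _.
rewrite mul_diag_mx !mxE eqxx mulr1n big_ord1 !mxE.
by field.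
Qed.

End MinimalSurface.

(** * The separable surface and the conclusion *)

Definition triple {T : Type} (a b c : T) (i : 'I_3) : T := nth a [:: a; b; c] i.

Lemma ord3_ind (P : 'I_3 -> Prop) : P 0 -> P 1 -> P 2 -> forall i, P i.
Proof.
move=> P0 P1 P2 [[|[|[|//]]] lt_i].
- by rewrite (_ : Ordinal lt_i = 0) //; exact: val_inj.
- by rewrite (_ : Ordinal lt_i = 1) //; exact: val_inj.
- by rewrite (_ : Ordinal lt_i = 2) //; exact: val_inj.
Qed.

Lemma big_ord3 (V : nmodType) (G : 'I_3 -> V) : \sum_i G i = G 0 + G 1 + G 2.
Proof.
rewrite !big_ord_recl big_ord0 addr0 addrA.
by congr (_ + G _ + G _); exact: val_inj.
Qed.

Lemma separable_surfaceE (R : realType) (I1 I2 I3 : set R) (f g h : R -> R) :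
  separable_surface I1 I2 I3 f g h =
  [set x : 'rV[R]_3 | (forall i, triple I1 I2 I3 i (x 0 i)) /\
    \sum_i triple f g h i (x 0 i) = 0].
Proof.
apply/seteqP; split => x; rewrite /separable_surface/= big_ord3.
  by case=> x1 x2 x3 s; split=> //; apply: ord3_ind.
by case=> Ix s; split=> //; [exact: (Ix 0) | exact: (Ix 1) | exact: (Ix 2)].
Qed.

(** Here [S = X + Y + Z], so [S - n_i nu_i] is the sum of the other two functions, and the common
    factor [1 / (2m)] carried by the derivatives of [nu] drops out. *)
Lemma separable_minimal_eq (R : realType) (m : nat) (I1 I2 I3 : set R)
    (f g h X Y Z : R -> R) :
  (2 <= m)%N ->
  open I1 -> is_interval I1 -> open I2 -> is_interval I2 ->
  open I3 -> is_interval I3 ->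
  smooth_on I1 f -> smooth_on I2 g -> smooth_on I3 h ->
  (forall t, I1 t -> derive1 f t != 0) ->
  (forall t, I2 t -> derive1 g t != 0) ->
  (forall t, I3 t -> derive1 h t != 0) ->
  minimal_surface m (separable_surface I1 I2 I3 f g h) ->
  (forall t, I1 t -> X (f t) = odd_root (2 * m - 1) (derive1 f t) ^+ (2 * m)) ->
  (forall t, I2 t -> Y (g t) = odd_root (2 * m - 1) (derive1 g t) ^+ (2 * m)) ->
  (forall t, I3 t -> Z (h t) = odd_root (2 * m - 1) (derive1 h t) ^+ (2 * m)) ->
  minimal_eq (f @` I1) (g @` I2) (h @` I3) X Y Z.
Proof.
move=> m2 o1 i1 o2 i2 o3 i3 sf sg sh f0 g0 h0 Mmin XE YE ZE.
move=> _ _ _ [x1 Ix1 <-] [x2 Ix2 <-] [x3 Ix3 <-] s.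
pose I := triple I1 I2 I3; pose F := triple f g h; pose G := triple X Y Z.
have oI i : open (I i) by move: i; apply: ord3_ind.
have iI i : is_interval (I i) by move: i; apply: ord3_ind.
have sF i : smooth_on (I i) (F i) by move: i; apply: ord3_ind.
have F0 i t : I i t -> derive1 (F i) t != 0.
  by move: i; apply: ord3_ind; [exact: f0 | exact: g0 | exact: h0].
have GE i t : I i t ->
    G i (F i t) = odd_root (2 * m - 1) (derive1 (F i) t) ^+ (2 * m).
  by move: i; apply: ord3_ind; [exact: XE | exact: YE | exact: ZE].
have dnu i t : I i t -> is_derive t 1
    (fun s => odd_root (2 * m - 1) (derive1 (F i) s))
    (derive1 (G i) (F i t) / (2 * m)%:R).
  exact: (is_derive_normal m2 (@oI i) (@iI i) (@sF i) (@F0 i) (@GE i)).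
pose p : 'rV[R]_3 := \row_i triple x1 x2 x3 i.
have [p0 p1 p2] : [/\ p 0 0 = x1, p 0 1 = x2 & p 0 2 = x3] by rewrite !mxE.
have Mp : [set x : 'rV[R]_3 | (forall i, I i (x 0 i)) /\
    \sum_i F i (x 0 i) = 0] p.
  split; first by apply: ord3_ind; rewrite ?p0 ?p1 ?p2.
  by rewrite big_ord3 p0 p1 p2.
move: Mmin; rewrite separable_surfaceE => /(_ p Mp)[eta [bg mc]].
have nE i : derive1 (F i) (p 0 i) * odd_root (2 * m - 1) (derive1 (F i) (p 0 i))
    = G i (F i (p 0 i)).
  rewrite mulrC; apply/esym/(factorE m2 (@GE i)).
  by case: Mp.
have SE : \sum_j derive1 (F j) (p 0 j) *
    odd_root (2 * m - 1) (derive1 (F j) (p 0 j)) =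
    X (f x1) + Y (g x2) + Z (h x3).
  by rewrite (eq_bigr _ (fun j _ => nE j)) big_ord3 p0 p1 p2.
have S0 : \sum_j derive1 (F j) (p 0 j) *
    odd_root (2 * m - 1) (derive1 (F j) (p 0 j)) != 0.
  rewrite SE gt_eqF// !addr_gt0//.
  - exact: (factor_gt0 m2 f0 XE).
  - exact: (factor_gt0 m2 g0 YE).
  - exact: (factor_gt0 m2 h0 ZE).
have := minimal_surface_eq oI iI sF F0 m2 dnu Mp bg S0 mc.
rewrite SE (eq_bigr (fun i => derive1 (G i) (F i (p 0 i)) / (2 * m)%:R *
  (X (f x1) + Y (g x2) + Z (h x3) - G i (F i (p 0 i))))); last first.
  by move=> i _; rewrite nE.
rewrite big_ord3 p0 p1 p2 /G /F /triple/=.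
move: (derive1 X _) (derive1 Y _) (derive1 Z _) (X _) (Y _) (Z _).
move=> a1 b1 c1 a b c H.
have m0 : (2 * m)%:R != 0 :> R by rewrite pnatr_eq0 muln_eq0/= -lt0n ltnW.
apply: (mulIf (invr_neq0 m0)); rewrite mul0r -[RHS]H.
by ring.
Qed.

Lemma separable_profile (R : realType) (m : nat) (I : set R) (f X : R -> R) :
  (2 <= m)%N -> open I -> is_interval I -> smooth_on I f ->
  (forall t, I t -> derive1 f t != 0) ->
  (forall t, I t -> derive1 (derive1 f) t != 0) ->
  (forall t, I t -> X (f t) = odd_root (2 * m - 1) (derive1 f t) ^+ (2 * m)) ->
  profile (f @` I) X.
Proof.
move=> m2 oI iI sf f'0 f''0 XE.
have df t : I t -> derivable f t 1 by move=> /sf /(_ 0%N).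
split.
- exact: (open_image_interval oI iI df f'0).
- exact: (is_interval_image iI df).
- exact: (smooth_factor m2 oI iI sf f'0 XE).
- by move=> _ [t It <-]; exact: (factor_gt0 m2 f'0 XE It).
- move=> _ [t It <-].
  exact: (derive1_factor_neq0 m2 oI iI sf f'0 f''0 XE It).
Qed.

Lemma mulf3_neq0 (A : idomainType) (a b c : A) :
  a * b * c != 0 -> [/\ a != 0, b != 0 & c != 0].
Proof. by rewrite !mulf_eq0 !negb_or => /andP[/andP[]]. Qed.

Theorem theorem6p1 (R : realType) (m : nat) (I1 I2 I3 : set R)
    (f g h X Y Z : R -> R)
    (hm : (2 <= m)%N)
    (oI1 : open I1) (iI1 : is_interval I1)
    (oI2 : open I2) (iI2 : is_interval I2)
    (oI3 : open I3) (iI3 : is_interval I3)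
    (sf : smooth_on I1 f) (sg : smooth_on I2 g) (sh : smooth_on I3 h)
    (d1 : forall x1 x2 x3, I1 x1 -> I2 x2 -> I3 x3 ->
       f^`()%classic x1 * g^`()%classic x2 * h^`()%classic x3 != 0)
    (d2 : forall x1 x2 x3, I1 x1 -> I2 x2 -> I3 x3 ->
       f^`(2)%classic x1 * g^`(2)%classic x2 * h^`(2)%classic x3 != 0)
    (M0 : separable_surface I1 I2 I3 f g h !=set0)
    (Mmin : minimal_surface m (separable_surface I1 I2 I3 f g h))
    (XE : forall x1, I1 x1 ->
       X (f x1) = odd_root (2 * m - 1) (f^`()%classic x1) ^+ (2 * m))
    (YE : forall x2, I2 x2 ->
       Y (g x2) = odd_root (2 * m - 1) (g^`()%classic x2) ^+ (2 * m))
    (ZE : forall x3, I3 x3 ->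
       Z (h x3) = odd_root (2 * m - 1) (h^`()%classic x3) ^+ (2 * m)) :
  let M := separable_surface I1 I2 I3 f g h in
  let U := [set f (x 0 0) | x in M] in
  let V := [set g (x 0 1) | x in M] in
  let W := [set h (x 0 2) | x in M] in
  exists a : R,
    [/\ forall u, U u -> X^`(3)%classic u / X^`()%classic u = a,
        forall v, V v -> Y^`(3)%classic v / Y^`()%classic v = a
      & forall w, W w -> Z^`(3)%classic w / Z^`()%classic w = a] /\
    exists p1 p2 p3 q1 q2 q3 r1 r2 r3 : R,
    [/\ forall b : R, 0 < a -> 0 < b -> a = b ^+ 2 ->
          [/\ forall u, U u -> X u = p1 + q1 * expR (b * u) + r1 * expR (- (b * u)),
              forall v, V v -> Y v = p2 + q2 * expR (b * v) + r2 * expR (- (b * v))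
            & forall w, W w -> Z w = p3 + q3 * expR (b * w) + r3 * expR (- (b * w))] /\
          [/\ (p2 + p3) * r1 - 2 * q2 * q3 = 0 /\ (p1 + p3) * r2 - 2 * q1 * q3 = 0,
              (p2 + p3) * q1 - 2 * r2 * r3 = 0 /\ (p1 + p3) * q2 - 2 * r1 * r3 = 0
            & (p1 + p2) * q3 - 2 * r1 * r2 = 0 /\ (p1 + p2) * r3 - 2 * q1 * q2 = 0],
        forall b : R, a < 0 -> 0 < b -> a = - b ^+ 2 ->
          [/\ forall u, U u -> X u = p1 + q1 * cos (b * u) + r1 * sin (b * u),
              forall v, V v -> Y v = p2 + q2 * cos (b * v) + r2 * sin (b * v)
            & forall w, W w -> Z w = p3 + q3 * cos (b * w) + r3 * sin (b * w)] /\
          [/\ (p2 + p3) * q1 - q2 * q3 + r2 * r3 = 0 /\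
              (p2 + p3) * r1 + q2 * r3 + q3 * r2 = 0,
              (p1 + p3) * q2 - q1 * q3 + r1 * r3 = 0 /\
              (p1 + p3) * r2 + q1 * r3 + q3 * r1 = 0
            & (p1 + p2) * q3 - q1 * q2 + r1 * r2 = 0 /\
              (p1 + p2) * r3 + q1 * r2 + q2 * r1 = 0]
      & a = 0 ->
          [/\ forall u, U u -> X u = p1 + q1 * u + r1 * u ^+ 2,
              forall v, V v -> Y v = p2 + q2 * v + r2 * v ^+ 2
            & forall w, W w -> Z w = p3 + q3 * w + r3 * w ^+ 2] /\
          [/\ (p2 + p3) * q1 + (p1 + p3) * q2 + (p1 + p2) * q3 = 0,
              2 * (p2 + p3) * r1 - 2 * (p1 + p2) * r3 + q2 * (q1 - q3) = 0 /\
              2 * (p1 + p3) * r2 - 2 * (p1 + p2) * r3 + q1 * (q2 - q3) = 0,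
              (q2 - q3) * r1 - (q1 - q2) * r3 = 0,
              (q1 - q3) * r2 + (q1 - q2) * r3 = 0
            & r1 * r2 + r1 * r3 + r2 * r3 = 0]].
Proof.
(* A point of M lies over all three intervals, which allows the nonvanishing of the products to be
   split into that of each factor. *)
have [x0 [Ix1 Ix2 Ix3 s0]] := M0.
have f0 t : I1 t -> derive1 f t != 0.
  by move=> It; have [+ _ _] := mulf3_neq0 (d1 _ _ _ It Ix2 Ix3).
have g0 t : I2 t -> derive1 g t != 0.
  by move=> It; have [_ + _] := mulf3_neq0 (d1 _ _ _ Ix1 It Ix3).
have h0 t : I3 t -> derive1 h t != 0.
  by move=> It; have [_ _ +] := mulf3_neq0 (d1 _ _ _ Ix1 Ix2 It).
have f0' t : I1 t -> derive1 (derive1 f) t != 0.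
  by move=> It; have [+ _ _] := mulf3_neq0 (d2 _ _ _ It Ix2 Ix3).
have g0' t : I2 t -> derive1 (derive1 g) t != 0.
  by move=> It; have [_ + _] := mulf3_neq0 (d2 _ _ _ Ix1 It Ix3).
have h0' t : I3 t -> derive1 (derive1 h) t != 0.
  by move=> It; have [_ _ +] := mulf3_neq0 (d2 _ _ _ Ix1 Ix2 It).
have pX := separable_profile hm oI1 iI1 sf f0 f0' XE.
have pY := separable_profile hm oI2 iI2 sg g0 g0' YE.
have pZ := separable_profile hm oI3 iI3 sh h0 h0' ZE.
have E := separable_minimal_eq hm oI1 iI1 oI2 iI2 oI3 iI3 sf sg sh f0 g0 h0
  Mmin XE YE ZE.
move=> M U V W.
have att x : M x -> [/\ attained (f @` I1) (g @` I2) (h @` I3) (f (x 0 0)),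
    attained (g @` I2) (f @` I1) (h @` I3) (g (x 0 1)) &
    attained (h @` I3) (f @` I1) (g @` I2) (h (x 0 2))].
  by move=> [J1 J2 J3 s]; apply: attained_rot.
have UJ u : U u -> attained (f @` I1) (g @` I2) (h @` I3) u.
  by move=> [x /att[+ _ _] <-].
have VJ v : V v -> attained (g @` I2) (f @` I1) (h @` I3) v.
  by move=> [x /att[_ + _] <-].
have WJ w : W w -> attained (h @` I3) (f @` I1) (g @` I2) w.
  by move=> [x /att[_ _ +] <-].
have [|a [[Xa Ya Za] [p1 [p2 [p3 [q1 [q2 [q3 [r1 [r2 [r3 [C1 C2 C3]]]]]]]]]]]] :=
  minimal_eq_solution pX pY pZ E.
  by exists (f (x0 0 0)); apply: UJ; exists x0.
exists a; split.
  by split; [move=> u /UJ/Xa|move=> v /VJ/Ya|move=> w /WJ/Za].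
exists p1, p2, p3, q1, q2, q3, r1, r2, r3; split.
- move=> b a0 b0 ab; have [[fX fY fZ] cs] := C1 b a0 b0 ab; split=> //.
  by split; [move=> u /UJ/fX[]|move=> v /VJ/fY[]|move=> w /WJ/fZ[]].
- move=> b a0 b0 ab; have [[fX fY fZ] cs] := C2 b a0 b0 ab; split=> //.
  by split; [move=> u /UJ/fX[]|move=> v /VJ/fY[]|move=> w /WJ/fZ[]].
- move=> a0; have [[fX fY fZ] cs] := C3 a0; split=> //.
  by split; [move=> u /UJ/fX[]|move=> v /VJ/fY[]|move=> w /WJ/fZ[]].
Qed.
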